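(* Suppose $1/n\ll1/K\ll\lambda\ll\alpha$. If $G$ is a digraph of order $(1+\alpha)n$ with $\delta^0(G)\ge(1/2+\alpha)n$, then $G$ contains every oriented tree $T$ of order $n$ with $\Delta(T)\le n^{(K\log n)^{-1/2}}$.
   Context: Hierarchy notation: $a\ll b$ means for every $b>0$ there is $a_0>0$ such that the statement holds for all $0<a<a_0$; for chains the constants are chosen right to left; $1/n\ll\cdot$ means $n$ sufficiently large. $\log$ is the natural logarithm. A digraph has no loops and at most one edge in each direction; $\delta^0(G)$ is the minimum over vertices of the minimum of in- and outdegree. An oriented tree is an orientation of a tree; $\Delta(T)$ is the maximum degree of the underlying tree. ''$G$ contains $T$'' means $G$ has a subdigraph isomorphic to $T$. *)

(* Defs.v *)
From HB Require Import structures.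
From mathcomp Require Import all_boot all_order all_algebra.
From mathcomp Require Import all_classical all_reals all_analysis.

Set Implicit Arguments.
Unset Strict Implicit.
Unset Printing Implicit Defensive.

Import Order.TTheory GRing.Theory Num.Theory.

(* The relation [edge] is not assumed antisymmetric: both edges x -> y and
   y -> x may be present. *)
Structure digraph := Digraph {
  vertex :> finType;
  edge : rel vertex;
  edge_irrefl : irreflexive edge
}.

Section Digraphs.
Implicit Types G T : digraph.

Definition gorder G : nat := #|vertex G|.

Definition outdeg G (x : G) : nat := #|[set y | edge x y]|.
Definition indeg G (x : G) : nat := #|[set y | edge y x]|.

(* Degrees never exceed [gorder G], so the neutral value [gorder G] only matters
   for the digraph without vertices. *)
Definition min_semideg G : nat :=
  \big[minn/gorder G]_(x : G) minn (outdeg x) (indeg x).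

Definition uadj G : rel G := fun x y => edge x y || edge y x.

Definition max_deg G : nat := \max_(x : G) #|[set y | uadj x y]|.

Definition oriented G : Prop := forall x y : G, edge x y -> ~~ edge y x.

Definition uconnected G : Prop :=
  (0 < gorder G)%N /\ forall x y : G, connect (@uadj G) x y.

(* A closed walk x, y, x along a single edge is a [ucycle] of size 2 but not a
   cycle of the underlying graph. *)
Definition uacyclic G : Prop :=
  forall c : seq G, ucycle (@uadj G) c -> (size c <= 2)%N.

Definition oriented_tree T : Prop := [/\ oriented T, uconnected T & uacyclic T].

(* A pair (S, F) represents the digraph with vertex set S and edge relation F. *)
Definition subdigraph G (S : {set G}) (F : rel G) : Prop :=
  forall x y, F x y -> [/\ x \in S, y \in S & edge x y].

Definition contains G T : Prop :=
  exists (S : {set G}) (F : rel G), subdigraph S F /\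
    exists f : T -> G, [/\ injective f, f @: [set: T] = S
                         & forall x y, F (f x) (f y) = edge x y].

Lemma containsP G T :
  contains G T <->
  exists2 f : T -> G, injective f & forall x y, edge x y -> edge (f x) (f y).
Proof.
split=> [[S [F [sub [f [f_inj _ fE]]]]] | [f f_inj f_hom]].
  by exists f => // x y; rewrite -fE => /sub[].
exists (f @: [set: T])%SET.
exists (fun u v => [exists x, exists y, [&& f x == u, f y == v & edge x y]]).
split=> [u v /existsP[x /existsP[y /and3P[/eqP<- /eqP<- xy]]] | ].
  by split; rewrite ?imset_f ?inE //; apply: f_hom.
exists f; split=> // x y; apply/existsP/idP => [[x'] | xy].
  by move=> /existsP[y' /and3P[/eqP/f_inj-> /eqP/f_inj->]].
by exists x; apply/existsP; exists y; rewrite !eqxx.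
Qed.

End Digraphs.

Local Open Scope ring_scope.

(* N is x rounded down or up to an integer (and N = x if x is an integer). *)
Definition rounding (R : realType) (x : R) (N : nat) : Prop :=
  `|N%:R - x| < 1.

(* Main.v *)
(* The vertices of T are embedded in pieces, each a subtree of size
   n^o(1), and every vertex of G keeps more than the proportion 1/2 + e of the
   unused set U in both its neighbourhoods. In U take a uniformly random
   permutation x |-> s x along edges of G: its transition matrix P is doubly
   stochastic, has entries of order 1/|U| on all edges, and contracts the
   oscillation of functions by a constant factor; its transpose plays the same
   role for reversed edges. Hence a random walk indexed by a piece is close to
   uniform on U for all but the first few generations, of which there are few
   vertices because Delta(T) is subpolynomial. By conditional expectations one
   can therefore embed a piece injectively so that any prescribed weight on U
   is hit essentially at its average rate. Applying this to the gradient of an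
   exponential potential of the relative degrees keeps all of them above
   1/2 + e until T is used up, because alpha n vertices remain. *)
Require Import Defs.
From HB Require Import structures.
From mathcomp Require Import all_boot all_order all_algebra all_fingroup.
From mathcomp Require Import all_classical all_reals all_analysis.
From mathcomp Require Import fintype finset.
From mathcomp Require Import zify ring lra.

Set Implicit Arguments.
Unset Strict Implicit.
Unset Printing Implicit Defensive.

Import Order.TTheory GRing.Theory Num.Theory.
Local Open Scope ring_scope.

(** * Rooting a forest *)

Section Forest.
Variable T : digraph.
Implicit Types (S : {set T}) (s : seq T).

Lemma uadj_sym : symmetric (@uadj T).
Proof. by move=> a b; rewrite /uadj orbC. Qed.

Lemma uadj_irr (a : T) : uadj a a = false.
Proof. by rewrite /uadj edge_irrefl. Qed.

Hypothesis acyc : uacyclic T.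

(* The first vertex of a longest path in [S] has no further neighbour in [S],
   since such a neighbour would close a cycle. *)
Lemma acyclic_leaf S : S != set0 ->
  exists2 v, v \in S & (#|[set w in S | uadj v w]| <= 1)%N.
Proof.
move=> /set0Pn[v0 v0S]; apply/exists_inP; apply: contraT.
rewrite negb_exists_in => /forall_inP deg2.
suff long m : exists x s, [/\ size s = m, path (@uadj T) x s, uniq (x :: s) & all (mem S) (x :: s)].
  have [x [s [szs _ us _]]] := long #|T|.
  by have := max_card (mem (x :: s)); rewrite (card_uniqP us) /= szs ltnn.
elim: m => [|m [x [s [szs ps us /andP[xS sS]]]]].
  by exists v0, [::]; rewrite /= v0S.
have := deg2 _ xS; rewrite -ltnNge => /card_gt1P[y1 [y2 [/=]]].
rewrite !inE => /andP[y1S xy1] /andP[y2S xy2] y12.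
have [y [yS xy yh]] : exists y, [/\ y \in S, uadj x y & y != head x s].
  case: (eqVneq y1 (head x s)) => [y1h|]; last by exists y1.
  by exists y2; split; rewrite // -y1h eq_sym.
have yx : y != x by apply: contraTneq xy => ->; rewrite uadj_irr.
case ys: (y \in s); last first.
  exists y, (x :: s); rewrite /= szs uadj_sym xy ps; split=> //.
    by move: us; rewrite /= !inE negb_or yx ys.
  by apply/and3P; split.
case/splitPr: s / ys szs ps us sS yh => s1 s2 szs ps us sS yh.
(* The stretch from [x] to [y] closes up to a cycle; size at most 2 leaves only [y = head x s],
   which is excluded. *)
have : (size (x :: rcons s1 y) <= 2)%N.
  apply: acyc; rewrite /ucycle; apply/andP; split.
    move: ps; rewrite -cat_rcons cat_path => /andP[ps _].
    by rewrite /= rcons_path ps last_rcons uadj_sym.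
  by move: us; rewrite -cat_rcons -cat_cons cat_uniq => /andP[].
rewrite /= size_rcons; case: s1 szs ps us sS yh => //=.
by rewrite eqxx.
Qed.

(** Vertices of degree at most 1 are peeled off one by one, each becoming the child of its remaining
    neighbour, if any. This roots every component, with [p] the parent and [k] the depth. *)
Lemma acyclic_parent : exists (p : T -> option T) (k : T -> nat),
  (forall a b, p a = Some b -> uadj a b /\ k a = (k b).+1) /\
  (forall a b, uadj a b -> p a = Some b \/ p b = Some a).
Proof.
suff H j S : #|S| = j -> exists (p : T -> option T) (k : T -> nat),
  (forall a b, p a = Some b -> [/\ a \in S, b \in S, uadj a b & k a = (k b).+1]) /\
  (forall a b, a \in S -> b \in S -> uadj a b -> p a = Some b \/ p b = Some a).
  have [p [k [H1 H2]]] := H _ [set: T] erefl; exists p, k; split=> a b.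
    by move=> /H1[].
  by apply: H2; rewrite inE.
elim: j S => [|j IH] S cS.
  move/eqP: cS; rewrite cards_eq0 => /eqP->.
  by exists (fun=> None), (fun=> 0); split=> // a b; rewrite inE.
have /acyclic_leaf[v vS dv] : S != set0 by rewrite -cards_eq0 cS.
have [|p [k [H1 H2]]] := IH (S :\ v).
  by move: (cardsD1 v S); rewrite vS cS add1n => -[].
exists (fun a => if a == v then [pick w in S | uadj v w] else p a).
exists (fun a => if a == v then (if [pick w in S | uadj v w] is Some w then (k w).+1 else 0%N) else k a).
split=> a b.
  case: eqVneq => [->|av].
    case: pickP => // w /andP[wS vw] [<-]; split=> //.
    by case: eqVneq => // wv; move: vw; rewrite wv uadj_irr.
  move/H1; rewrite !inE => -[/andP[_ aS] /andP[bv bS] ab kab].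
  by split=> //; rewrite (negPf bv).
have uniqw w : w \in S -> uadj v w -> [pick w in S | uadj v w] = Some w.
  move=> wS vw; case: pickP => [w' /andP[wS' vw']|/(_ w)]; last by rewrite wS vw.
  congr Some; move/card_le1_eqP: dv; apply; rewrite inE ?wS' ?wS //.
move=> aS bS ab; case: (eqVneq a v) => [av|av]; first by left; apply: uniqw; rewrite -?av.
case: (eqVneq b v) => [bv|bv]; first by right; apply: uniqw; rewrite -?bv // uadj_sym.
by apply: H2; rewrite ?inE ?av ?bv.
Qed.

End Forest.

(** * One-factors of a dense digraph and switchings between them *)

Section Factors.
Variables (V : finType) (E : rel V) (U : {set V}).
Implicit Types (s : {perm V}) (x y a c : V).

Lemma card_pairs_ge (S W : finType) (A : {set S}) (X : {set S * W}) (k : nat) :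
  (forall t, t \in A -> (k <= #|[set c | (t, c) \in X]|)%N) ->
  (#|A| * k <= #|X|)%N.
Proof.
move=> H; rewrite -sum_nat_const.
have -> : #|X| = (\sum_t \sum_(c | (t, c) \in X) 1)%N.
  by rewrite pair_big_dep /= -sum1_card; apply: eq_bigl => -[t c].
rewrite [leqRHS](bigID (mem A)) /= -[leqLHS]addn0; apply: leq_add => //.
by apply: leq_sum => t /H; rewrite sum1dep_card.
Qed.

(** The 1-factors of the digraph induced on [U], as permutations fixing everything outside [U]. *)
Definition factors := [set s | perm_on U s & [forall x in U, E x (s x)]].

Lemma factorsP s :
  reflect (perm_on U s /\ forall x, x \in U -> E x (s x)) (s \in factors).
Proof.
by rewrite inE; apply: (iffP andP) => -[sU H]; split=> //; apply/forall_inP.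
Qed.

Lemma card_nbr_perm s x : perm_on U s ->
  #|[set c in U | E x (s c)]| = #|[set y in U | E x y]|.
Proof.
move=> sU; rewrite -(card_preimset [set y in U | E x y] (@perm_inj _ s)).
by apply: eq_card => c; rewrite !inE (perm_closed c sU).
Qed.

Variable d : nat.
Hypothesis outd : forall x, x \in U -> (d <= #|[set y in U | E x y]|)%N.
Hypothesis ind : forall y, y \in U -> (d <= #|[set x in U | E x y]|)%N.

(* Augmentation: if a permutation [s] with the most edges [(x, s x)] has a bad
   point [x], exchanging the images of [x] and a suitable [a] repairs it. *)
Lemma factors_neq0 : (#|U| <= 2 * d)%N -> factors != set0.
Proof.
move=> Ud; apply/set0Pn.
case: (@arg_maxnP _ (1%g : {perm V}) (perm_on U)
  (fun s => #|[set x in U | E x (s x)]|) (perm_on1 U)) => s sU smax.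
exists s; apply/factorsP; split=> // x xU; apply: contraT => nE.
set A := [set a in U | E x (s a)]; set B := [set a in U | E a (s x)].
have sxU : s x \in U by rewrite (perm_closed x sU).
have : (0 < #|A :&: B|)%N.
  have dA : (d <= #|A|)%N by rewrite card_nbr_perm // outd.
  have dB : (d <= #|B|)%N by rewrite ind.
  (* The point [x] lies in neither [A] nor [B]; this gains the 1 that inclusion-exclusion needs when
     [#|U| = 2 * d]. *)
  have ABU : (#|A :|: B| < #|U|)%N.
    apply/proper_card/properP; split; last first.
      by exists x; rewrite // !inE (negPf nE) andbF.
    by apply/subsetP => a; rewrite !inE => /orP[] /andP[].
  by have := cardsUI A B; lia.
case/card_gt0P => a; rewrite !inE => /andP[/andP[aU Exa] /andP[_ Eax]].
have ax : a != x by apply: contraNneq nE => ax; rewrite -{2}ax.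
have tU : perm_on U (tperm x a).
  apply/subsetP => z; rewrite inE => zt; apply: contraR zt => zU.
  by apply/eqP; rewrite tpermD //; apply: contraNneq zU => <-.
have le := smax (tperm x a * s)%g (perm_onM tU sU).
rewrite -(ltnn #|[set x0 in U | E x0 (s x0)]|); apply: leq_trans le.
apply/proper_card/properP; split.
  apply/subsetP => z; rewrite !inE permM => /andP[zU Ez]; rewrite zU /=.
  case: tpermP => [zx|za|_ _] //; first by rewrite zx in Ez; rewrite Ez in nE.
  by rewrite za.
by exists x; rewrite !inE ?xU /= ?(negPf nE) // permM tpermL.
Qed.

(** Inclusion-exclusion inside [U]. For such [c] the edge from [c] to [s c] can be given up: [x]
    takes over the image [s c], and [c] is sent to [y]. *)
Lemma card_common s x y : perm_on U s -> x \in U -> y \in U ->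
  (2 * d - #|U| <= #|[set c in U | E x (s c) & E c y]|)%N.
Proof.
move=> sU xU yU.
set A := [set a in U | E x (s a)]; set B := [set a in U | E a y].
have -> : [set c in U | E x (s c) & E c y] = A :&: B.
  by apply/setP => c; rewrite !inE; case: (c \in U).
have dA : (d <= #|A|)%N by rewrite card_nbr_perm // outd.
have dB : (d <= #|B|)%N by rewrite ind.
have ABU : (#|A :|: B| <= #|U|)%N.
  by apply/subset_leq_card/subsetP => a; rewrite !inE => /orP[] /andP[].
by have := cardsUI A B; lia.
Qed.

Lemma card_common2 s x y a b : perm_on U s -> x \in U -> y \in U ->
  (2 * d - #|U| - 2 <= #|[set c | [&& c \in U, c != a, c != b, E x (s c) & E c y]]|)%N.
Proof.
move=> sU xU yU; set A := [set c | _].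
have := card_common sU xU yU; set B := [set c in U | _ & _].
have : B \subset A :|: [set a; b].
  apply/subsetP => c; rewrite !inE => /and3P[-> -> ->].
  by case: (eqVneq c a); case: (eqVneq c b).
move/subset_leq_card => BA.
have [+ _] := leq_card_setU A [set a; b].
have : (#|[set a; b]| <= 2)%N by rewrite cards2; case: eqP.
lia.
Qed.

(** The 3-cycle taking [x] to [a], [a] to [c] and [c] to [x]; the left factor of a product acts
    first. *)
Definition rot3 x a c : {perm V} := (tperm a c * tperm x a)%g.

Lemma rot3E x a c : x != a -> c != x -> c != a ->
  [/\ rot3 x a c x = a, rot3 x a c a = c & rot3 x a c c = x].
Proof.
move=> xa cx ca; rewrite /rot3; split; rewrite permM.
- by rewrite (@tpermD _ a c x) ?tpermL // eq_sym.
- by rewrite tpermL tpermD // 1?eq_sym.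
- by rewrite tpermR tpermR.
Qed.

Lemma rot3D x a c z : z != x -> z != a -> z != c -> rot3 x a c z = z.
Proof. by move=> zx za zc; rewrite /rot3 permM !tpermD // eq_sym. Qed.

Lemma rot3VE x a c : x != a -> c != x -> c != a ->
  [/\ (rot3 x a c)^-1%g x = c, (rot3 x a c)^-1%g a = x & (rot3 x a c)^-1%g c = a].
Proof.
move=> xa cx ca; have [rx ra rc] := rot3E xa cx ca.
by split; apply: (@perm_inj _ (rot3 x a c)); rewrite permKV.
Qed.

Lemma rot3VD x a c z : z != x -> z != a -> z != c -> (rot3 x a c)^-1%g z = z.
Proof. by move=> zx za zc; apply: (@perm_inj _ (rot3 x a c)); rewrite permKV rot3D. Qed.

Lemma rot3_on x a c : x \in U -> a \in U -> c \in U -> perm_on U (rot3 x a c).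
Proof.
move=> xU aU cU; rewrite /perm_on; apply/subsetP => z; rewrite inE; apply: contraR => zU.
by apply/eqP/rot3D; apply: contraNneq zU => ->.
Qed.

Section Switch.
Variables x y : V.
Hypothesis Exy : E x y.
Hypotheses (xU : x \in U) (yU : y \in U).

Let Fxy := [set s in factors | s x == y].

(* Switching: composing a factor [s] with the 3-cycle on [x], [a] and [c], where
   [s a = y], produces a factor that maps [x] to [y]. Counting the admissible [c]
   (resp. [(a, c)] for the inverse operation) bounds the proportion of factors
   mapping [x] to [y] from below (resp. above). *)
Lemma switch_lower :
  ((#|factors| - #|Fxy|) * (2 * d - #|U| - 2) <= #|Fxy| * (#|U| * #|U|))%N.
Proof.
pose pre s := (s^-1)%g y.
pose X := [set u : {perm V} * V | [&& u.1 \in factors, u.1 x != y &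
  [&& u.2 \in U, u.2 != x, u.2 != pre u.1, E (pre u.1) (u.1 u.2) & E u.2 (u.1 x)]]].
(* Recording both [a = pre s] and [c] makes the switching injective, at the price of the factor
   [#|U| * #|U|]. *)
pose phi (u : {perm V} * V) := ((rot3 x (pre u.1) u.2 * u.1)%g, (pre u.1, u.2)).
have preE s : s (pre s) = y by rewrite permKV.
have -> : (#|factors| - #|Fxy| = #|[set s in factors | s x != y]|)%N.
  have -> : [set s in factors | s x != y] = factors :\: Fxy.
    apply/setP => s; rewrite in_setD [LHS]in_set.
    have -> : (s \in Fxy) = (s \in factors) && (s x == y) by rewrite [LHS]in_set.
    by case: (s \in factors); case: (s x == y).
  by rewrite cardsD (setIidPr _) //; apply/subsetP => s; rewrite !inE => /andP[].
apply: (@leq_trans #|X|).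
  apply: card_pairs_ge => s; rewrite inE => /andP[sF sxy].
  have [sU sE] := factorsP _ sF.
  have aU : pre s \in U by rewrite -(perm_closed _ sU) preE.
  have sxU : s x \in U by rewrite (perm_closed _ sU).
  apply: leq_trans (card_common2 x (pre s) sU aU sxU) _.
  by apply/subset_leq_card/subsetP => c; rewrite inE => Hc; rewrite in_set in_set /= sF sxy.
rewrite -cardsX -(@card_in_imset _ _ phi); last first.
  move=> [s c] [s' c'] _ _ [] /= e ea ec.
  by move: e; rewrite -ea -ec => /mulgI ->.
rewrite -cardsX; apply/subset_leq_card/subsetP => _ /imsetP[[s c] + ->].
rewrite inE /= => /and3P[sF sxy /and5P[cU cx ca Ea Ec]].
have [sU sE] := factorsP _ sF.
have aU : pre s \in U by rewrite -(perm_closed _ sU) preE.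
have xa : x != pre s by apply: contra_neq sxy => ->; rewrite preE.
have [rx ra rc] := rot3E xa cx ca.
rewrite /phi !in_setX /= aU cU !andbT inE permM rx preE eqxx andbT.
apply/factorsP; split; first by rewrite perm_onM ?rot3_on.
move=> z zU; rewrite permM.
case: (eqVneq z x) => [->|zx]; first by rewrite rx preE.
case: (eqVneq z (pre s)) => [->|za]; first by rewrite ra.
case: (eqVneq z c) => [->|zc]; first by rewrite rc.
by rewrite rot3D // sE.
Qed.

Lemma switch_upper :
  (#|Fxy| * ((d - 1) * (2 * d - #|U| - 2)) <= #|factors| * #|U|)%N.
Proof.
pose Y := [set u : {perm V} * (V * V) | [&& u.1 \in Fxy,
  [&& u.2.1 \in U, u.2.1 != x & E u.2.1 y] &
  [&& u.2.2 \in U, u.2.2 != x, u.2.2 != u.2.1, E x (u.1 u.2.2) & E u.2.2 (u.1 u.2.1)]]].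
(* Only [c] is recorded: [a] is recovered as the point that the new factor maps to [y]. Saving one
   factor [#|U|] here yields an upper bound of order [1 / #|U|]. *)
pose psi (u : {perm V} * (V * V)) := (((rot3 x u.2.1 u.2.2)^-1 * u.1)%g, u.2.2).
apply: (@leq_trans #|Y|).
  apply: card_pairs_ge => s sF; have := sF; rewrite inE => /andP[/factorsP[sU sE] sxy].
  apply: leq_trans (_ : #|[set a in U | E a y] :\ x| * (2 * d - #|U| - 2) <= _)%N.
    rewrite leq_mul2r; apply/orP; right.
    have := cardsD1 x [set a in U | E a y]; have := ind yU.
    by case: (_ \in _); lia.
  apply: card_pairs_ge => a; rewrite !inE => /and3P[ax aU Ea].
  have saU : s a \in U by rewrite (perm_closed _ sU).
  apply: leq_trans (card_common2 x a sU xU saU) _.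
  by apply/subset_leq_card/subsetP => c; rewrite inE => Hc; rewrite in_set in_set in_set /= sF ax aU Ea.
have YP s a c : (s, (a, c)) \in Y -> [/\ s \in Fxy, a \in U, x != a & E a y] /\
   [/\ c \in U, c != x, c != a, E x (s c) & E c (s a)].
  rewrite in_set /= => /and3P[? /and3P[? ax ?] /and5P[? ? ? ? ?]].
  by split; split; rewrite // eq_sym.
rewrite -cardsX -(@card_in_imset _ _ psi); last first.
  move=> [s [a c]] [s' [a' c']] /YP[[sF _ xa _] [_ cx ca _ _]] /YP[[sF' _ xa' _] [_ cx' ca' _ _]] [] /= e ec.
  move: e cx' ca'; rewrite -ec => e cx' ca'.
  have sx : s x = y by move: sF; rewrite inE => /andP[_ /eqP].
  have sx' : s' x = y by move: sF'; rewrite inE => /andP[_ /eqP].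
  have [_ ra _] := rot3VE xa cx ca; have [_ ra' _] := rot3VE xa' cx' ca'.
  have aa : a = a'.
    apply: (@perm_inj _ ((rot3 x a c)^-1 * s)%g); rewrite permM ra sx.
    by rewrite e permM ra' sx'.
  by move: e; rewrite -aa => /mulgI ->.
apply/subset_leq_card/subsetP => _ /imsetP[[s [a c]] /YP[[sF aU xa Ea] [cU cx ca Exc Eca]] ->].
have := sF; rewrite inE => /andP[/factorsP[sU sE] /eqP sx].
have [rx ra rc] := rot3VE xa cx ca.
rewrite in_setX /= cU andbT; apply/factorsP; split.
  by rewrite perm_onM // perm_onV // rot3_on.
move=> z zU; rewrite permM.
case: (eqVneq z x) => [->|zx]; first by rewrite rx.
case: (eqVneq z a) => [->|za]; first by rewrite ra sx.
case: (eqVneq z c) => [->|zc]; first by rewrite rc.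
by rewrite rot3VD // sE.
Qed.

End Switch.
End Factors.

(** * Doubly stochastic kernels supported on edges *)

Section Kernel.
Variables (R : realType) (V : finType).
Implicit Types (E : rel V) (U : {set V}) (P : V -> V -> R) (h : V -> R).

Definition conv E : rel V := fun x y => E y x.

Definition semideg_ge E U (c : R) := forall x, x \in U ->
  c <= #|[set y in U | E x y]|%:R /\ c <= #|[set y in U | E y x]|%:R.

(** [kernel_lower] makes the walk contract oscillations; [kernel_upper] keeps the probability of
    hitting a small set of used vertices small. *)
Record kernel E U (e : R) P : Prop := Kernel {
  kernel_ge0 : forall x y, 0 <= P x y;
  kernel_supp : forall x y, x \in U -> ~~ E x y -> P x y = 0;
  kernel_row : forall x, x \in U -> \sum_(y in U) P x y = 1;
  kernel_col : forall y, y \in U -> \sum_(x in U) P x y = 1;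
  kernel_lower : forall x y, x \in U -> y \in U -> E x y -> e / (2 * #|U|%:R) <= P x y;
  kernel_upper : forall x y, x \in U -> y \in U -> P x y <= 2 / (e * #|U|%:R) }.

Lemma kernel_conv E U e P :
  (forall x y, y \in U -> ~~ E x y -> P x y = 0) ->
  kernel E U e P -> kernel (conv E) U e (fun x y => P y x).
Proof.
move=> H [k0 ks kr kc kl ku]; split=> //.
- by move=> x y xU; apply: H.
- by move=> x y xU yU; apply: kl.
- by move=> x y xU yU; apply: ku.
Qed.

(* [P x y] is the probability that a uniformly random factor maps [x] to [y];
   it is doubly stochastic because factors are permutations. *)
Lemma kernel_exists E U e : 0 < e -> 2 <= e * #|U|%:R ->
  semideg_ge E U ((2^-1 + e) * #|U|%:R) ->
  exists P, kernel E U e P /\ kernel (conv E) U e (fun x y => P y x).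
Proof.
move=> e0 eu deg; set u := #|U|%:R in eu deg *.
have u0 : 0 < u by rewrite -(pmulr_rgt0 _ e0); lra.
(* [d] is the least natural number above the real degree bound, so minimality transfers the bound to
   all degrees. *)
have [d ud [outd ind]] : exists2 d : nat, (2^-1 + e) * u <= d%:R :> R &
   (forall x, x \in U -> (d <= #|[set y in U | E x y]|)%N) /\
   (forall y, y \in U -> (d <= #|[set x in U | E x y]|)%N).
  have ex : exists d : nat, (2^-1 + e) * u <= d%:R :> R.
    move: u0; rewrite ltr0n => /card_gt0P[x /deg[+ _]]; by exists #|[set y in U | E x y]|.
  case: (ex_minnP ex) => d ud dmin; exists d => //.
  by split=> x /deg[dx dx']; apply: dmin.
(* The number of admissible [c] in a switching. Since [2 * d - u >= 2 * e * u] and [e * u >= 2], the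
   subtraction is not truncated and [A >= e * u]. *)
set A := (2 * d - #|U| - 2)%N.
have eqA : A%:R = 2 * d%:R - u - 2 :> R.
  have ud2 : (#|U| + 2 <= 2 * d)%N by rewrite -(ler_nat R) natrD natrM -/u; nra.
  by rewrite /A -subnDA natrB // natrD natrM -/u; ring.
have A0 : e * u <= A%:R by rewrite eqA; nra.
have d1 : (0 < d)%N by rewrite -(ltr_nat R); nra.
have eqd : (d - 1)%:R = d%:R - 1 :> R by rewrite natrB.
have F0 : (0 < #|factors E U|)%N.
  rewrite card_gt0; apply: (factors_neq0 outd ind).
  by rewrite -(ler_nat R) natrM -/u; nra.
set F := factors E U in F0; pose Fxy x y := [set s in F | s x == y].
have f0 : 0 < #|F|%:R :> R by rewrite ltr0n.
pose P x y : R := #|Fxy x y|%:R / #|F|%:R.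
have Fle x y : (#|Fxy x y| <= #|F|)%N.
  by apply/subset_leq_card/subsetP => s; rewrite in_set => /andP[].
have FP s : s \in F -> perm_on U s /\ forall x, x \in U -> E x (s x) by move/factorsP.
have P0 x y : 0 <= P x y by rewrite divr_ge0.
have supp x y : (x \in U) || (y \in U) -> ~~ E x y -> P x y = 0.
  move=> xyU nE; rewrite /P [Fxy x y](_ : _ = set0) ?cards0 ?mul0r //.
  apply/setP => s; rewrite in_set in_set0; apply/negP => /andP[/FP[sU sE] /eqP sx].
  case/orP: xyU => [xU|yU]; first by move: (sE _ xU); rewrite sx (negPf nE).
  have xU : x \in U by rewrite -(perm_closed _ sU) sx.
  by move: (sE _ xU); rewrite sx (negPf nE).
have row x : x \in U -> \sum_(y in U) P x y = 1.
  move=> xU; rewrite -mulr_suml -natr_sum.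
  suff -> : (\sum_(y in U) #|Fxy x y| = #|F|)%N by rewrite divff ?gt_eqF.
  rewrite -[RHS]sum1_card (partition_big (fun s : {perm V} => s x) (mem U)) /=; last first.
    by move=> s /FP[sU _]; rewrite (perm_closed _ sU).
  by apply: eq_bigr => y _; rewrite -sum1_card; apply: eq_bigl => s; rewrite in_set.
have col y : y \in U -> \sum_(x in U) P x y = 1.
  move=> yU; rewrite -mulr_suml -natr_sum.
  suff -> : (\sum_(x in U) #|Fxy x y| = #|F|)%N by rewrite divff ?gt_eqF.
  rewrite -[RHS]sum1_card (partition_big (fun s : {perm V} => (s^-1)%g y) (mem U)) /=; last first.
    by move=> s /FP[sU _]; rewrite (perm_closed _ (perm_onV sU)).
  apply: eq_bigr => x _; rewrite -sum1_card; apply: eq_bigl => s; rewrite in_set.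
  by congr (_ && _); apply/eqP/eqP => [<-|<-]; rewrite ?permK ?permKV.
have low x y : x \in U -> y \in U -> E x y -> e / (2 * u) <= P x y.
  move=> xU yU Exy; have := switch_lower outd ind Exy xU yU.
  rewrite -/F -/A -/(Fxy x y) -(ler_nat R) !natrM natrB // -/u => sw.
  rewrite /P ler_pdivlMr // mulrAC ler_pdivrMr ?mulr_gt0 //.
  set a := #|Fxy x y|%:R in sw *; set b := #|F|%:R in sw f0 *.
  have ab : a <= b by rewrite ler_nat.
  have a0 : 0 <= a by rewrite ler0n.
  have A1 : (b - a) * (e * u) <= (b - a) * A%:R by rewrite ler_wpM2l // subr_ge0.
  have e1 : e <= 1.
    have [dx _] := deg _ xU.
    have : (#|[set y0 in U | E x y0]| <= #|U|)%N.
      by apply/subset_leq_card/subsetP => z; rewrite in_set => /andP[].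
    by rewrite -(ler_nat R) -/u => dx'; rewrite -(ler_pM2r u0); lra.
  have e1u : e * u <= 1 * u by rewrite ler_wpM2r // ltW.
  have eu1 : e * u <= u * u by apply: ler_wpM2r; [exact: ltW | lra].
  have au : a * (e * u) <= a * (u * u) by rewrite ler_wpM2l.
  by rewrite -(ler_pM2r u0); lra.
have upp x y : x \in U -> y \in U -> P x y <= 2 / (e * u).
  move=> xU yU; case Exy: (E x y); last first.
    by rewrite supp ?xU ?Exy // divr_ge0 // ?mulr_ge0 ?ltW.
  have := switch_upper outd ind Exy xU yU.
  rewrite -/F -/A -/(Fxy x y) -(ler_nat R) !natrM eqd -/u => sw.
  rewrite /P ler_pdivrMr // mulrAC ler_pdivlMr ?mulr_gt0 //.
  set a := #|Fxy x y|%:R in sw *; set b := #|F|%:R in sw f0 *.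
  have a0 : 0 <= a by rewrite ler0n.
  have h1 : (u / 2) * (e * u) <= (d%:R - 1) * A%:R by apply: ler_pM => //; nra.
  have h2 : a * ((u / 2) * (e * u)) <= b * u by apply: le_trans sw; rewrite ler_wpM2l.
  by rewrite -(ler_pM2r u0); lra.
have K : kernel E U e P by split=> // x y xU; apply: supp; rewrite xU.
exists P; split=> //; apply: kernel_conv => // x y yU; apply: supp; by rewrite yU orbT.
Qed.

Section Apply.
Variables (E : rel V) (U : {set V}) (e : R) (P : V -> V -> R).
Hypotheses (e0 : 0 < e) (eu : 2 <= e * #|U|%:R).
Hypothesis deg : semideg_ge E U ((2^-1 + e) * #|U|%:R).
Hypothesis K : kernel E U e P.

(** The conditional expectation of [h] one step of the walk after [x]. *)
Definition apply_kernel P h x : R := \sum_(y in U) P x y * h y.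

Let u0 : 0 < #|U|%:R :> R.
Proof. by rewrite -(pmulr_rgt0 _ e0) (lt_le_trans _ eu). Qed.

(** Columns sum to 1, so the uniform measure on [U] is stationary. *)
Lemma sum_apply_kernel h : \sum_(x in U) apply_kernel P h x = \sum_(y in U) h y.
Proof.
rewrite exchange_big /=; apply: eq_bigr => y yU.
by rewrite -mulr_suml (kernel_col K) ?mul1r.
Qed.

Lemma common_outnbr x x' : x \in U -> x' \in U ->
  2 * e * #|U|%:R <= #|[set y in U | E x y && E x' y]|%:R :> R.
Proof.
move=> /deg[dx _] /deg[dx' _].
set A := [set y in U | E x y] in dx; set B := [set y in U | E x' y] in dx'.
have -> : [set y in U | E x y && E x' y] = A :&: B.
  by apply/setP => y; rewrite !inE; case: (y \in U).
have : (#|A :|: B| <= #|U|)%N.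
  by apply/subset_leq_card/subsetP => y; rewrite !inE => /orP[] /andP[].
move/eqP: (cardsUI A B); rewrite -(eqr_nat R) -(ler_nat R) !natrD => /eqP.
lra.
Qed.

(* Dobrushin's argument: any two rows share mass at least [e ^+ 2] on the common
   outneighbours of [x] and [x']. *)
Lemma kernel_contract h (O : R) :
  (forall x y, x \in U -> y \in U -> h x - h y <= O) ->
  forall x x', x \in U -> x' \in U ->
    apply_kernel P h x - apply_kernel P h x' <= (1 - e ^+ 2) * O.
Proof.
move=> osc x x' xU x'U.
have O0 : 0 <= O by rewrite -(subrr (h x)) osc.
pose m z := Num.min (P x z) (P x' z).
have summ : e ^+ 2 <= \sum_(z in U) m z.
  rewrite (bigID (fun z => E x z && E x' z)) /=.
  have : 0 <= \sum_(z in U | ~~ (E x z && E x' z)) m z.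
    by apply: sumr_ge0 => z _; rewrite /m le_min !(kernel_ge0 K).
  suff : e ^+ 2 <= \sum_(z in U | E x z && E x' z) m z by lra.
  apply: le_trans (_ : \sum_(z in U | E x z && E x' z) e / (2 * #|U|%:R) <= _); last first.
    apply: ler_sum => z /and3P[zU xz x'z].
    by rewrite /m le_min !(kernel_lower K).
  rewrite big_const iter_addr_0 -(mulr_natr (_ / _)).
  have := common_outnbr xU x'U; rewrite (_ : #|[set _ in _ | _]| = #|[pred z in U | E x z && E x' z]|); last first.
    by apply: eq_card => z; rewrite in_set.
  move=> cn; rewrite mulrAC ler_pdivlMr ?mulr_gt0 //.
  by rewrite expr2 -mulrA (mulrCA e) ler_wpM2l ?(ltW e0) //; nra.
(* Subtracting the minimum of [h] puts its values on [U] in [[0, O]]; the shared mass [m] cancels,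
   and at most [1 - e ^+ 2] of the row of [x] is left. *)
have [z0 z0U z0min] : exists2 z0, z0 \in U & forall z, z \in U -> h z0 <= h z.
  by case: (@arg_minP _ _ _ x (mem U) h xU) => z0 z0U zm; exists z0.
have sumE y : y \in U -> apply_kernel P h y - h z0 = \sum_(z in U) P y z * (h z - h z0).
  move=> yU; under eq_bigr do rewrite mulrBr.
  by rewrite sumrB -mulr_suml (kernel_row K yU) mul1r.
rewrite (_ : _ - _ = (apply_kernel P h x - h z0) - (apply_kernel P h x' - h z0)); last by ring.
rewrite !sumE // -sumrB.
apply: le_trans (_ : \sum_(z in U) (P x z - m z) * O <= _).
  apply: ler_sum => z zU.
  have h1 : 0 <= h z - h z0 by rewrite subr_ge0 z0min.
  have h2 : h z - h z0 <= O by apply: osc.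
  have m1 : m z <= P x z by rewrite /m ge_min lexx.
  have m2 : m z <= P x' z by rewrite /m ge_min lexx orbT.
  by nra.
rewrite -mulr_suml sumrB (kernel_row K xU) ler_wpM2r //; lra.
Qed.

(** By [kernel_upper] the step from [y] hits [B] with probability at most
    [b = 2 * #|B| / (e * #|U|) <= 1/2]. Conditioning on avoiding [B] thus raises the expectation by
    at most [2 * b * O], and some outneighbour does no worse than the conditional expectation. *)
Lemma kernel_avoid h (O : R) (B : {set V}) y :
  (forall x y, x \in U -> y \in U -> h x - h y <= O) ->
  y \in U -> B \subset U -> 4 * #|B|%:R <= e * #|U|%:R ->
  exists2 z, z \in U :\: B /\ E y z &
    h z <= apply_kernel P h y + 4 * #|B|%:R / (e * #|U|%:R) * O.
Proof.
move=> osc yU BU Bs.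
have O0 : 0 <= O by rewrite -(subrr (h y)) osc.
set b := 2 * #|B|%:R / (e * #|U|%:R).
have eu0 : 0 < e * #|U|%:R by rewrite mulr_gt0.
have b2 : b <= 2^-1 by rewrite /b ler_pdivrMr //; lra.
have b0 : 0 <= b by rewrite divr_ge0 ?mulr_ge0 // ltW.
have -> : 4 * #|B|%:R / (e * #|U|%:R) = 2 * b by rewrite /b; field; rewrite !gt_eqF.
set a := apply_kernel P h y.
set pB := \sum_(z in B) P y z.
have pBb : pB <= b.
  apply: le_trans (_ : \sum_(z in B) 2 / (e * #|U|%:R) <= _).
    by apply: ler_sum => z zB; rewrite (kernel_upper K) // (subsetP BU).
  by rewrite sumr_const -(mulr_natr (_ / _)) mulrAC lexx.
have pB0 : 0 <= pB by apply: sumr_ge0 => z _; rewrite (kernel_ge0 K).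
have splitU (F : V -> R) : \sum_(z in U) F z = \sum_(z in B) F z + \sum_(z in U :\: B) F z.
  by rewrite (big_setID B) /= (setIidPr BU).
have pC : \sum_(z in U :\: B) P y z = 1 - pB.
  by rewrite -(kernel_row K yU) splitU -/pB addrC addKr.
have [z1 /andP[z1U yz1]] : exists z, (z \in U :\: B) && E y z.
  apply/existsP; apply: contraT; rewrite negb_exists => /forallP nz.
  have : \sum_(z in U :\: B) P y z = 0.
    apply: big1 => z zU; apply: (kernel_supp K yU).
    by move: (nz z); rewrite zU.
  by rewrite pC; lra.
have [z0 /andP[z0U yz0] z0min] : exists2 z0, (z0 \in U :\: B) && E y z0 &
    forall z, (z \in U :\: B) && E y z -> h z0 <= h z.
  have z1P : [pred z | (z \in U :\: B) && E y z] z1 by rewrite /= z1U.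
  by case: (arg_minP h z1P) => z0 z0U zm; exists z0.
exists z0 => //.
have suma : \sum_(z in U) P y z * (h z - a) = 0.
  under eq_bigr do rewrite mulrBr.
  by rewrite sumrB -mulr_suml (kernel_row K yU) mul1r subrr.
have h1 : - O * pB <= \sum_(z in B) P y z * (h z - a).
  rewrite mulr_sumr; apply: ler_sum => z zB; rewrite mulrC ler_wpM2l ?(kernel_ge0 K) //.
  have zU : z \in U by rewrite (subsetP BU).
  suff : a <= h z + O by lra.
  rewrite -[leRHS]mul1r -(kernel_row K yU) mulr_suml.
  apply: ler_sum => w wU; rewrite ler_wpM2l ?(kernel_ge0 K) //.
  by have := osc w z wU zU; lra.
have h2 : (1 - pB) * (h z0 - a) <= \sum_(z in U :\: B) P y z * (h z - a).
  rewrite -pC mulr_suml; apply: ler_sum => z zU.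
  case yz: (E y z); last first.
    by rewrite (kernel_supp K yU) ?yz // !mul0r.
  by rewrite ler_wpM2l ?(kernel_ge0 K) // lerD2r z0min // zU.
rewrite splitU in suma.
have h3 : (1 - pB) * (h z0 - a) <= O * b.
  have : O * pB <= O * b by rewrite ler_wpM2l.
  by lra.
rewrite -lerBlDl leNgt; apply/negP => lt.
have bO : 0 <= b * O by rewrite mulr_ge0.
have : 2^-1 * (h z0 - a) <= (1 - pB) * (h z0 - a) by rewrite ler_wpM2r //; lra.
lra.
Qed.
End Apply.
End Kernel.

(** * Embedding one piece by conditional expectations *)

Section Embedding.
Variables (R : realType) (G T : digraph) (p : T -> option T) (k : T -> nat).
Hypothesis p_edge : forall a b, p a = Some b -> uadj a b /\ k a = (k b).+1.
Hypothesis edge_p : forall a b, uadj a b -> p a = Some b \/ p b = Some a.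
Hypothesis orT : oriented T.
Implicit Types (A D S : {set T}) (f : T -> G) (U B : {set G}).

Definition dir_edge (b : bool) : rel G := if b then @edge G else conv (@edge G).

Definition parent_closed S := forall a b, p a = Some b -> a \in S -> b \in S.

Definition embeds S f := {in S &, injective f} /\
  {in S &, forall a b, edge a b -> edge (f a) (f b)}.

(** As [S] is closed under parents, it contains no child of [l], so the parent is the only possible
    neighbour of [l] in [S]; as [T] is oriented, only one direction has to be respected there. *)
Lemma embeds_add S f (l : T) (z : G) : l \notin S -> parent_closed S ->
  (forall q, p l = Some q -> q \in S /\ dir_edge (edge q l) (f q) z) ->
  z \notin f @: S -> embeds S f ->
  embeds (l |: S) (fun t => if t == l then z else f t).
Proof.
move=> lS cS pl zS [fi fe].
have nl t : t \in S -> (t == l) = false by move=> tS; apply: contraNF lS => /eqP <-.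
have zf t : t \in S -> z <> f t by move=> tS zf; rewrite zf imset_f in zS.
have adj t : t \in S -> uadj l t -> dir_edge (edge t l) (f t) z.
  by move=> tS /edge_p[/pl[] // | /cS H]; move: (H tS); rewrite (negPf lS).
split=> a b; rewrite !inE.
  case: eqVneq => [->|al] /= aS; case: eqVneq => [->|bl] //= bS.
  - by move/(zf _ bS).
  - by move/esym/(zf _ aS).
  - exact: fi.
case: eqVneq => [->|al] /= aS; case: eqVneq => [->|bl] /= bS ab.
- by rewrite edge_irrefl in ab.
- by have := adj b bS; rewrite /uadj ab /= (negPf (orT ab)); apply.
- by have := adj a aS; rewrite /uadj ab orbT; apply.
- exact: fe.
Qed.

Section Piece.
Variables (U : {set G}) (e : R) (P : G -> G -> R) (A : {set T}) (f0 : T -> G) (M : nat).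
Hypotheses (e0 : 0 < e) (eu : 2 <= e * #|U|%:R).
Hypothesis deg : forall (v : G) b, (2^-1 + e) * #|U|%:R <= #|[set y in U | dir_edge b v y]|%:R :> R.
Hypothesis K : kernel (@edge G) U e P.
Hypothesis K' : kernel (conv (@edge G)) U e (fun x y => P y x).
Hypotheses (cA : parent_closed A) (emb0 : embeds A f0).
Hypothesis f0U : forall t, t \in A -> f0 t \notin U.
Hypothesis MU : 4 * M%:R <= e * #|U|%:R :> R.

Let dirP b : G -> G -> R := if b then P else (fun x y => P y x).
Let Kdir b : kernel (dir_edge b) U e (dirP b).
Proof. by case: b. Qed.

Let degdir b : semideg_ge (dir_edge b) U ((2^-1 + e) * #|U|%:R).
Proof.
move=> x _; split; first exact: deg.
by have := deg x (~~ b); case: b.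
Qed.

Let u0 : 0 < #|U|%:R :> R.
Proof. by rewrite -(pmulr_rgt0 _ e0) (lt_le_trans _ eu). Qed.

Let e1 : e <= 1.
Proof.
have /card_gt0P[v _] : (0 < #|U|)%N by rewrite -(ltr0n R).
have : (#|[set y in U | dir_edge true v y]| <= #|U|)%N.
  by apply/subset_leq_card/subsetP => z; rewrite in_set => /andP[].
rewrite -(ler_nat R) => h; have := le_trans (deg v true) h.
by rewrite -[leRHS]mul1r ler_pM2r //; lra.
Qed.

Definition avg (h : G -> R) : R := (\sum_(z in U) h z) / #|U|%:R.

Let le_avg (h : G -> R) (O : R) z : z \in U ->
  (forall x y, x \in U -> y \in U -> h x - h y <= O) -> h z <= avg h + O.
Proof.
move=> zU osc; rewrite -lerBlDr /avg ler_pdivlMr // mulr_natr -sumr_const.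
by apply: ler_sum => w wU; have := osc z w zU wU; lra.
Qed.

(** The relative loss in [kernel_avoid] when at most [M] vertices are forbidden; the series with
    ratio [1 - e ^+ 2] sums it to [err / e ^+ 2]. *)
Let err : R := 4 * M%:R / (e * #|U|%:R).

Let err0 : 0 <= err.
Proof. by rewrite /err divr_ge0 // mulr_ge0 // ltW. Qed.

(** Serves vertices without a parent, whose image is free. Deleting [B] costs only [O * M / #|U|],
    which is weakened to the form of the other cases. *)
Let min_avg (h : G -> R) (O : R) B : B \subset U -> (#|B| <= M)%N ->
  (forall x y, x \in U -> y \in U -> h x - h y <= O) ->
  exists2 z, z \in U :\: B & h z <= avg h + O * (err / e ^+ 2).
Proof.
move=> BU BM osc.
have /card_gt0P[z1 z1U] : (0 < #|U :\: B|)%N.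
  rewrite cardsD (setIidPr BU) subn_gt0 -(ltr_nat R).
  have : #|B|%:R <= M%:R :> R by rewrite ler_nat.
  have : e * #|U|%:R <= 1 * #|U|%:R by rewrite ler_wpM2r.
  by have := MU; have := u0; lra.
have [z0 z0U z0min] : exists2 z0, z0 \in U :\: B & forall z, z \in U :\: B -> h z0 <= h z.
  by case: (@arg_minP _ _ _ z1 (mem (U :\: B)) h z1U) => z0 z0U zm; exists z0.
exists z0 => //.
have z0u : z0 \in U by move: z0U; rewrite inE => /andP[].
have O0 : 0 <= O by rewrite -(subrr (h z0)) osc.
apply: le_trans (_ : avg h + O * (M%:R / #|U|%:R) <= _); last first.
  rewrite lerD2l ler_wpM2l // /err ler_pdivrMr // mulrAC ler_pdivlMr ?exprn_gt0 //.
  rewrite mulrAC ler_pdivlMr ?mulr_gt0 // expr2.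
  have h1 : e * e * e <= 1 by rewrite !mulr_ile1 ?mulr_ge0 ?(ltW e0) ?e1.
  have : (e * e * e) * (M%:R * #|U|%:R) <= 1 * (M%:R * #|U|%:R) by rewrite ler_wpM2r ?mulr_ge0.
  have : 0 <= (M%:R * #|U|%:R) :> R by rewrite mulr_ge0.
  by lra.
rewrite /avg mulrA -mulrDl ler_pdivlMr //.
have -> : \sum_(z in U) h z = \sum_(z in B) h z + \sum_(z in U :\: B) h z.
  by rewrite (big_setID B) /= (setIidPr BU).
have h1 : \sum_(z in B) (h z0 - O) <= \sum_(z in B) h z.
  by apply: ler_sum => z /(subsetP BU) zU; have := osc z0 z z0u zU; lra.
have h2 : \sum_(z in U :\: B) h z0 <= \sum_(z in U :\: B) h z.
  by apply: ler_sum => z /z0min.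
move: h1 h2; rewrite !sumr_const -(mulr_natr (h z0 - O)) -(mulr_natr (h z0)).
rewrite -(cardsID B U) (setIidPr BU) natrD.
have : O * #|B|%:R <= O * M%:R by rewrite ler_wpM2l // ler_nat.
by lra.
Qed.

(* Induction on [D], removing a deepest vertex [l]: its weight [W l] is moved to
   its parent as the conditional expectation [P (W l)], which has the same average
   and an oscillation smaller by a factor [1 - e ^+ 2]. So avoiding the used
   vertices costs a geometric series per vertex, and the dependence on the image
   of the already embedded parent of the piece is damped by [a t]. *)
Lemma extend_piece D (W : T -> G -> R) (O a : T -> R) :
  [disjoint D & A] -> parent_closed (A :|: D) -> (#|D| <= M)%N ->
  (forall t x y, t \in D -> x \in U -> y \in U -> W t x - W t y <= O t) ->
  (forall t, t \in D -> 0 <= a t) ->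
  (forall t q, t \in D -> p t = Some q ->
    if q \in D then (1 - e ^+ 2) * a q <= a t else 1 <= a t) ->
  exists f, [/\ forall t, t \in A -> f t = f0 t,
    forall t, t \in D -> f t \in U, embeds (A :|: D) f &
    \sum_(t in D) W t (f t) <=
    \sum_(t in D) (avg (W t) + O t * (err / e ^+ 2 + a t))].
Proof.
move En : #|D| => n; elim: n D En W O => [|n IH] D En W O dA cD DM osc a0 ap.
  move/eqP: En; rewrite cards_eq0 => /eqP D0; exists f0; split=> //.
  - by move=> t; rewrite D0 inE.
  - by rewrite D0 setU0.
  - by rewrite D0 !big_set0.
have /card_gt0P[l1 l1D] : (0 < #|D|)%N by rewrite En.
have [l lD lmax] : exists2 l, l \in D & forall t, t \in D -> (k t <= k l)%N.
  by case: (@arg_maxnP _ l1 (mem D) k l1D) => l lD lm; exists l.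
have lA : l \notin A by rewrite (disjointFr dA).
pose D' := D :\ l.
have cD' : #|D'| = n by have := cardsD1 l D; rewrite lD En add1n => -[].
have lAD' : l \notin A :|: D' by rewrite !inE eqxx (negPf lA).
have lU : l |: (A :|: D') = A :|: D by rewrite setUCA setD1K.
have subD t : t \in D' -> t \in D by rewrite inE => /andP[].
have dA' : [disjoint D' & A] by apply: disjointWl dA; apply/subsetP.
have nochild t : t \in A :|: D -> p t <> Some l.
  move=> tAD ptl; have [_ kt] := p_edge ptl.
  case/setUP: tAD => [tA|/lmax]; first by move: (cA ptl tA); rewrite (negPf lA).
  by rewrite kt ltnn.
have cAD' : parent_closed (A :|: D').
  move=> b q pbq bS.
  have bS' : b \in A :|: D by rewrite -lU inE bS orbT.
  have := cD _ _ pbq bS'; rewrite -lU inE => /orP[|//].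
  by rewrite inE => /eqP ql; case: (nochild _ bS'); rewrite -ql.
have oscl x y : x \in U -> y \in U -> W l x - W l y <= O l by apply: osc.
have Ol : 0 <= O l.
  have /card_gt0P[v vU] : (0 < #|U|)%N by rewrite -(ltr0n R).
  by rewrite -(subrr (W l v)) oscl.
(* Common end of the three cases below: only the image [z] of [l] remains to be chosen. *)
have finish f z : (forall t, t \in A -> f t = f0 t) -> (forall t, t \in D' -> f t \in U) ->
    embeds (A :|: D') f -> z \in U :\: f @: D' ->
    (forall q, p l = Some q -> dir_edge (edge q l) (f q) z) ->
    W l z + \sum_(t in D') W t (f t) <=
      \sum_(t in D) (avg (W t) + O t * (err / e ^+ 2 + a t)) ->
    exists f, [/\ forall t, t \in A -> f t = f0 t,
      forall t, t \in D -> f t \in U, embeds (A :|: D) f &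
      \sum_(t in D) W t (f t) <=
      \sum_(t in D) (avg (W t) + O t * (err / e ^+ 2 + a t))].
  move=> fA fD fe; rewrite inE => /andP[zD zU] fz le.
  exists (fun t => if t == l then z else f t); split.
  - by move=> t tA; rewrite -fA //; case: eqVneq => // tl; rewrite tl (negPf lA) in tA.
  - by move=> t tD; case: eqVneq => // tl; apply: fD; rewrite !inE tl.
  - rewrite -lU; apply: embeds_add => //.
      move=> q pq; split; last exact: fz.
      have := cD _ _ pq; rewrite !inE lD orbT => /(_ isT) /orP[->//|->].
      case: eqVneq => [ql|]; rewrite ?orbT //.
      by have [_] := p_edge pq; rewrite ql => /n_Sn.
    rewrite imsetU inE (negPf zD) orbF; apply/imsetP => -[t tA zt].
    by move: (f0U tA); rewrite -fA // -zt zU.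
  - rewrite (bigD1 l) //= eqxx; apply: le_trans le; rewrite lerD2l.
    rewrite le_eqVlt; apply/orP; left; apply/eqP.
    by apply: eq_big => [t|t /andP[_ /negPf ->]] //; rewrite !inE andbC.
have sumD (F : T -> R) : \sum_(t in D) F t = F l + \sum_(t in D') F t.
  by rewrite (bigD1 l) //=; congr (_ + _); apply: eq_bigl => t; rewrite !inE andbC.
have BU f : (forall t, t \in D' -> f t \in U) -> f @: D' \subset U.
  by move=> fU; apply/subsetP => _ /imsetP[t /fU ? ->].
have BM f : (#|f @: D'| <= M)%N.
  by apply: leq_trans (leq_imset_card _ _) _; rewrite cD' -ltnS ltnW.
have DM' : (n <= M)%N by rewrite -ltnS ltnW.
have osc' t x y : t \in D' -> x \in U -> y \in U -> W t x - W t y <= O t.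
  by move/subD; apply: osc.
have a0' t : t \in D' -> 0 <= a t by move/subD; apply: a0.
have ap' t q : t \in D' -> p t = Some q ->
    if q \in D' then (1 - e ^+ 2) * a q <= a t else 1 <= a t.
  move=> tD ptq; have := ap _ _ (subD _ tD) ptq; rewrite !inE.
  case: eqVneq => // ql; case: (nochild t); last by rewrite -ql.
  by rewrite inE subD ?orbT.
case pl: (p l) => [q|]; last first.
  have [f [fA fD fe fW]] := IH D' cD' W O dA' cAD' DM' osc' a0' ap'.
  have [z zU zW] := min_avg (BU _ fD) (BM f) oscl.
  apply: (finish f z) => //; first by move=> q; rewrite pl.
  rewrite sumD; apply: lerD => //; apply: le_trans zW _.
  by rewrite lerD2l ler_wpM2l // lerDl a0.
(* Here the parent lies in [A] and its image is fixed, so no averaging is possible: any free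
   neighbour is taken, and the loss of up to [O l] is paid for by [1 <= a l]. *)
case qD: (q \in D); last first.
  have [f [fA fD fe fW]] := IH D' cD' W O dA' cAD' DM' osc' a0' ap'.
  have [z zU] : exists z, (z \in U :\: f @: D') && dir_edge (edge q l) (f q) z.
    have : (0 < #|[set y in U | dir_edge (edge q l) (f q) y] :\: f @: D'|)%N.
      rewrite cardsD subn_gt0; apply: leq_ltn_trans (subset_leq_card (subsetIr _ _)) _.
      rewrite -(ltr_nat R); apply: lt_le_trans (deg _ _).
      have : #|f @: D'|%:R <= M%:R :> R by rewrite ler_nat.
      have : e * #|U|%:R <= 1 * #|U|%:R by rewrite ler_wpM2r.
      have : 0 < e * #|U|%:R by rewrite mulr_gt0.
      by have := MU; have := u0; lra.
    by case/card_gt0P => z; rewrite !inE => /and3P[h1 h2 h3]; exists z; rewrite !inE h1 h2.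
  case/andP: zU => zU qz.
  apply: (finish f z) => //; first by move=> q'; rewrite pl => -[<-].
  rewrite sumD; apply: lerD => //.
  have zu : z \in U by move: zU; rewrite inE => /andP[].
  apply: le_trans (le_avg zu oscl) _; rewrite lerD2l -[leLHS]mulr1 ler_wpM2l //.
  have := ap _ _ lD pl; rewrite qD => a1; apply: le_trans a1 _; rewrite lerDr.
  by rewrite divr_ge0 // exprn_ge0 // ltW.
set b := edge q l.
have ql : q != l by apply/eqP => ql; have [_] := p_edge pl; rewrite ql => /n_Sn.
have qD' : q \in D' by rewrite !inE ql.
pose Kl := apply_kernel U (dirP b) (W l).
pose W' t x := if t == q then W q x + Kl x else W t x.
pose O' t := if t == q then O q + (1 - e ^+ 2) * O l else O t.
have oscW t x y : t \in D' -> x \in U -> y \in U -> W' t x - W' t y <= O' t.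
  rewrite /W' /O' => tD xU yU; case: eqVneq => [tq|_]; last exact: osc'.
  have := kernel_contract e0 eu (degdir b) (Kdir b) oscl xU yU.
  by have := osc' _ _ _ qD' xU yU; rewrite /Kl; lra.
have [f [fA fD fe fW]] := IH D' cD' W' O' dA' cAD' DM' oscW a0' ap'.
have cB : 4 * #|f @: D'|%:R <= e * #|U|%:R.
  have : #|f @: D'|%:R <= M%:R :> R by rewrite ler_nat.
  by have := MU; lra.
have [z [zU qz] zW] := kernel_avoid e0 eu (Kdir b) oscl (fD _ qD') (BU _ fD) cB.
apply: (finish f z) => //; first by move=> q'; rewrite pl => -[<-].
have zW' : W l z <= Kl (f q) + err * O l.
  apply: le_trans zW _; rewrite lerD2l ler_wpM2r //.
  have eu0 : 0 <= e * #|U|%:R by rewrite mulr_ge0 // ltW.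
  by rewrite /err ler_wpM2r ?invr_ge0 // ler_wpM2l // ler_nat.
have sW : \sum_(t in D') W' t (f t) = Kl (f q) + \sum_(t in D') W t (f t).
  rewrite (bigD1 q) //= [in RHS](bigD1 q) //= /W' eqxx.
  rewrite (eq_bigr (fun t => W t (f t))); first by ring.
  by move=> t /andP[_ /negPf ->].
have avgK : avg Kl = avg (W l) by rewrite /avg (sum_apply_kernel (Kdir b)).
have sR : \sum_(t in D') (avg (W' t) + O' t * (err / e ^+ 2 + a t)) =
    avg (W l) + (1 - e ^+ 2) * O l * (err / e ^+ 2 + a q) +
    \sum_(t in D') (avg (W t) + O t * (err / e ^+ 2 + a t)).
  rewrite (bigD1 q) //= [in RHS](bigD1 q) //= /W' /O' eqxx -avgK.
  have -> : avg (fun x => W q x + Kl x) = avg (W q) + avg Kl.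
    by rewrite /avg big_split /= mulrDl.
  rewrite (eq_bigr (fun t => avg (W t) + O t * (err / e ^+ 2 + a t))); first by ring.
  by move=> t /andP[_ /negPf ->].
rewrite sumD.
have aq : (1 - e ^+ 2) * a q * O l <= a l * O l.
  by rewrite ler_wpM2r //; have := ap _ _ lD pl; rewrite qD.
(* [x = err / e ^+ 2] solves [err + (1 - e ^+ 2) * x = x], so the error bound reproduces itself when
   weight moves to the parent. *)
have eE : err = e ^+ 2 * (err / e ^+ 2) by field; rewrite gt_eqF.
move: fW; rewrite sW sR; set x := err / e ^+ 2 in eE *.
by rewrite eE in zW'; lra.
Qed.

End Piece.
End Embedding.

(** * Cutting a rooted forest into small pieces *)

Section Pieces.
Variables (R : realType) (T : digraph) (p : T -> option T) (k : T -> nat) (Delta : nat).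
Hypothesis p_depth : forall a b, p a = Some b -> k a = (k b).+1.
Hypothesis children : forall q, (#|[set t | p t == Some q]| <= Delta)%N.
Hypothesis Delta_gt0 : (0 < Delta)%N.
Implicit Types (S D : {set T}) (x : T).

(** Thus [D] consists of the descendants of [x] in [S]: by [piece_compl], no vertex of [S] outside
    [D] has its parent in [D]. *)
Record piece S D x : Prop := Piece {
  piece_sub : D \subset S;
  piece_root : x \in D;
  piece_compl : parent_closed p (S :\: D);
  piece_parent : forall t, t \in D -> t != x -> exists2 q, p t = Some q & q \in D }.

(** A deepest vertex with at least [m] descendants in [S] works: each of its at most [Delta]
    children has fewer than [m]. If there is none, a vertex of least depth is a root with a small
    tree below it. *)
Lemma piece_exists S m : parent_closed p S -> S != set0 -> exists D x,
  [/\ piece S D x, (#|D| <= 1 + Delta * m)%N & p x = None \/ (m <= #|D|)%N].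
Proof.
move=> cS S0; pose par : rel T := fun t q => p t == Some q.
pose desc x := [set t in S | connect par t x].
have closed_con t x : t \in S -> connect par t x -> x \in S.
  move=> tS /connectP[s]; elim: s t tS => [|y s IH] t tS /=; first by move=> _ ->.
  by case/andP => /eqP ty ys; apply: IH => //; apply: cS ty tS.
have descP x : x \in S -> piece S (desc x) x.
  move=> xS; split.
  - by apply/subsetP => t; rewrite inE => /andP[].
  - by rewrite inE xS connect0.
  - move=> a b pab; rewrite !inE => /andP[+ aS]; rewrite aS /= (cS _ _ pab aS) /= andbT.
    by apply: contra; apply: connect_trans; apply: connect1; rewrite /par pab.
  - move=> t; rewrite inE => /andP[tS /connectP[[|q s]]] /=; first by move=> _ ->; rewrite eqxx.
    case/andP => /eqP tq qs xE _; exists q => //; rewrite inE (cS _ _ tq tS).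
    by apply/connectP; exists s.
case: (pickP [pred x in S | m <= #|desc x|]%N) => [x0 /= x0P|small].
  have [x /andP[xS xm] xmax] : exists2 x, (x \in S) && (m <= #|desc x|)%N &
      forall y, (y \in S) && (m <= #|desc y|)%N -> (k y <= k x)%N.
    case: (@arg_maxnP _ x0 [pred x in S | m <= #|desc x|]%N k x0P) => x xP xm.
    by exists x.
  exists (desc x), x; split; [exact: descP | | by right].
  pose C := [set t | p t == Some x].
  have sub : desc x \subset x |: \bigcup_(c in C :&: S) desc c.
    apply/subsetP => t; rewrite !inE => /andP[tS /connectP[s]].
    case/lastP: s => [|s y] /=; first by move=> _ ->; rewrite eqxx.
    rewrite rcons_path last_rcons => /andP[ps yP] xy; rewrite -xy in yP.
    apply/orP; right; apply/bigcupP; exists (last t s); last first.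
      by rewrite inE tS; apply/connectP; exists s.
    rewrite !inE; apply/andP; split; first exact: yP.
    by apply: (closed_con t) => //; apply/connectP; exists s.
  apply: leq_trans (subset_leq_card sub) _.
  apply: leq_trans (leq_card_setU _ _) _; rewrite cards1 leq_add2l.
  apply: leq_trans (_ : \sum_(c in C :&: S) m <= _)%N; last first.
    rewrite sum_nat_const leq_mul2r; apply/orP; right.
    by apply: leq_trans (children x); apply/subset_leq_card/subsetIl.
  apply: leq_trans (_ : \sum_(c in C :&: S) #|desc c| <= _)%N.
    elim/big_rec2: _ => [|c s B _ IH]; first by rewrite cards0.
    by apply: leq_trans (leq_card_setU _ _) _; rewrite leq_add2l.
  apply: leq_sum => c; rewrite !inE => /andP[/eqP cx cS'].
  rewrite leqNgt; apply/negP => cm; have := xmax c; rewrite cS' ltnW // => /(_ isT).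
  by rewrite (p_depth cx) ltnn.
have [x0 x0S] := set0Pn _ S0.
have [x xS xmin] : exists2 x, x \in S & forall y, y \in S -> (k x <= k y)%N.
  by case: (@arg_minnP _ x0 (mem S) k x0S) => x xS xm; exists x.
exists (desc x), x; split; first exact: descP.
  have := small x; rewrite inE xS /= => /negbT; rewrite -ltnNge => /ltnW lt.
  by apply: leq_trans lt _; rewrite (leq_trans (leq_pmull m Delta_gt0)) ?leq_addl.
left; case px: (p x) => [q|//]; have := xmin q (cS _ _ px xS).
by rewrite (p_depth px) ltnn.
Qed.

Section Depth.
Variables (S D : {set T}) (x : T).
Hypothesis pD : piece S D x.

Lemma piece_depth t : t \in D -> (k x <= k t)%N.
Proof.
have [j] := ubnP (k t); elim: j t => [|j IH] t // kt tD.
case: (eqVneq t x) => [->//|/(piece_parent pD tD)[q ptq qD]].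
rewrite (p_depth ptq) ltnW // ltnS IH //.
by move: kt; rewrite (p_depth ptq) ltnS.
Qed.

Lemma piece_level i : (#|[set t in D | k t == k x + i]| <= Delta ^ i)%N.
Proof.
elim: i => [|i IH].
  rewrite expn0 addn0 -(cards1 x); apply/subset_leq_card/subsetP => t.
  rewrite !inE => /andP[tD /eqP kt]; apply: contraT => tx.
  have [q ptq qD] := piece_parent pD tD tx.
  by have := piece_depth qD; rewrite -kt (p_depth ptq) ltnn.
set L := [set t in D | k t == k x + i]%N in IH.
apply: leq_trans (_ : #|\bigcup_(q in L) [set t | p t == Some q]| <= _)%N.
  apply/subset_leq_card/subsetP => t; rewrite !inE => /andP[tD /eqP kt].
  have [tx|tx] := eqVneq t x; first by move: kt; rewrite tx; lia.
  have [q ptq qD] := piece_parent pD tD tx.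
  apply/bigcupP; exists q; last by rewrite inE ptq.
  by rewrite inE qD /=; move: kt; rewrite (p_depth ptq); lia.
apply: leq_trans (_ : \sum_(q in L) Delta <= _)%N.
  apply: leq_trans (_ : \sum_(q in L) #|[set t | p t == Some q]| <= _)%N.
    elim/big_rec2: _ => [|c s B _ IH']; first by rewrite cards0.
    by apply: leq_trans (leq_card_setU _ _) _; rewrite leq_add2l.
  by apply: leq_sum => q _; apply: children.
by rewrite sum_nat_const expnS mulnC leq_mul2l IH orbT.
Qed.

Lemma piece_ball r : (#|[set t in D | k t < k x + r]| <= r * Delta ^ r)%N.
Proof.
elim: r => [|r IH].
  rewrite mul0n leqn0 cards_eq0; apply/eqP/setP => t; rewrite !inE addn0.
  by case tD: (t \in D) => //=; rewrite ltnNge piece_depth.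
apply: leq_trans (_ : #|[set t in D | k t < k x + r] :|: [set t in D | k t == k x + r]| <= _)%N.
  apply/subset_leq_card/subsetP => t; rewrite !inE => /andP[-> /=]; lia.
apply: leq_trans (leq_card_setU _ _) _.
apply: leq_trans (leq_add IH (piece_level r)) _.
by rewrite -mulSnr leq_mul2l expnS leq_pmull ?orbT.
Qed.

(** The first [r] generations have at most [r * Delta ^ r] vertices, contributing at most 1 each;
    every later vertex contributes at most [rho ^+ r]. *)
Lemma sum_piece_decay (rho : R) r : 0 <= rho -> rho <= 1 ->
  \sum_(t in D) rho ^+ (k t - k x) <= (r * Delta ^ r)%:R + rho ^+ r * #|D|%:R.
Proof.
move=> r0 r1; pose B := [set t in D | k t < k x + r]%N.
apply: le_trans (_ : \sum_(t in D) ((t \in B)%:R + rho ^+ r) <= _).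
  apply: ler_sum => t tD; rewrite inE tD /=; case: ltnP => kt /=.
    by rewrite -[leLHS]addr0 lerD ?exprn_ge0 ?exprn_ile1.
  by rewrite add0r ler_wiXn2l //; lia.
rewrite big_split /= sumr_const -(mulr_natr (rho ^+ r)) lerD2r -natr_sum ler_nat.
apply: leq_trans (piece_ball r); rewrite -sum1_card -/B.
rewrite (bigID (mem B)) /= [X in (_ + X)%N]big1 ?addn0; last by move=> t /andP[_ /negPf->].
rewrite [leqRHS](_ : _ = (\sum_(t in D | t \in B) 1)%N).
  by apply: leq_sum => t /andP[_ ->].
by apply: eq_bigl => t; rewrite inE; case: (t \in D).
Qed.

End Depth.
End Pieces.

(** * The exponential potential of the relative degrees *)

Section Potential.
Variables (R : realType) (G : digraph).
Implicit Types (U Q : {set G}) (lam beta : R).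

(** Follows from [1 - x <= expR (- x)] and [(1 - x) * (1 + x + 2 * x ^+ 2) = 1 + x ^+ 2 * (1 - 2 *
    x) >= 1]. *)
Lemma expR_quadratic (x : R) : `|x| <= 2^-1 -> expR x <= 1 + x + 2 * x ^+ 2.
Proof.
rewrite ler_norml => /andP[x1 x2].
have h : 1 - x <= (expR x)^-1 by rewrite -expRN; apply: expR_ge1Dx.
have e0 := expR_gt0 x.
have h2 : (1 - x) * expR x <= 1 by rewrite -ler_pdivlMr // div1r.
have h3 : 1 <= (1 - x) * (1 + x + 2 * x ^+ 2).
  have : 0 <= x ^+ 2 * (1 - 2 * x) by rewrite mulr_ge0 ?sqr_ge0 //; lra.
  by rewrite !expr2; lra.
have x3 : 0 < 1 - x by lra.
by rewrite -(ler_pM2l x3) (le_trans h2).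
Qed.

(* [vb] ranges over the vertices together with a direction. *)
Definition ddeg (vb : G * bool) U : nat := #|[set y in U | dir_edge vb.2 vb.1 y]|.

Definition weight lam beta U vb : R := expR (lam * (beta - (ddeg vb U)%:R / #|U|%:R)).

Definition potential lam beta U : R := \sum_vb weight lam beta U vb.

(** Up to a positive factor and a term common to all [z], the first-order growth of the potential
    when [z] leaves [U]. *)
Definition cost lam beta U (z : G) : R :=
  \sum_(vb | dir_edge vb.2 vb.1 z) weight lam beta U vb.

Lemma cost_ge0 lam beta U z : 0 <= cost lam beta U z.
Proof. by apply: sumr_ge0 => vb _; apply: expR_ge0. Qed.

Lemma cost_le lam beta U z : cost lam beta U z <= potential lam beta U.
Proof.
rewrite /potential (bigID (fun vb : G * bool => dir_edge vb.2 vb.1 z)) /= lerDl.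
by apply: sumr_ge0 => vb _; apply: expR_ge0.
Qed.

Lemma sum_cost lam beta U Q :
  \sum_(z in Q) cost lam beta U z = \sum_vb weight lam beta U vb * (ddeg vb Q)%:R.
Proof.
rewrite /cost (exchange_big_dep xpredT) //=; apply: eq_bigr => vb _.
rewrite sumr_const mulr_natr; congr (_ *+ _); apply: eq_card => z.
by rewrite !inE.
Qed.

(* [potential < 1] forces every relative degree into [U] above [beta]; linearising
   the exponentials turns the change of the potential into the weight [cost] of the
   removed set [Q]. *)
Lemma potential_step lam beta U Q (L delta : R) :
  Q \subset U -> 0 < lam -> (#|Q| < #|U|)%N -> lam <= L * (#|U|%:R - #|Q|%:R) ->
  delta <= 1 -> 2 * (L * #|Q|%:R) <= delta ->
  \sum_(z in Q) cost lam beta U z <=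
    #|Q|%:R * (avg U (cost lam beta U) + delta * potential lam beta U) ->
  potential lam beta (U :\: Q) <= potential lam beta U * expR (2 * L * delta * #|Q|%:R).
Proof.
move=> QU lam0 ltQ lamL d1 dL; rewrite /avg !sum_cost.
set u := #|U|%:R; set c := #|Q|%:R; set Phi := potential lam beta U => HQ.
pose w := weight lam beta U; rewrite -/w in HQ.
have c0 : 0 <= c by rewrite ler0n.
have uc : 0 < u - c by rewrite subr_gt0 ltr_nat.
have u0 : 0 < u by lra.
have L0 : 0 <= L by rewrite -(pmulr_lge0 _ uc) (le_trans (ltW lam0)).
have Lc0 : 0 <= L * c by rewrite mulr_ge0.
have u'E : #|U :\: Q|%:R = u - c :> R by rewrite cardsD (setIidPr QU) natrB // ltnW.
have dE vb : (ddeg vb U = ddeg vb Q + ddeg vb (U :\: Q))%N.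
  rewrite /ddeg -(cardsID Q [set y in U | _]); congr addn; apply: eq_card => z; rewrite !inE.
    by rewrite andbC; case zQ: (z \in Q) => //=; rewrite (subsetP QU _ zQ).
  by rewrite andbA.
(* The exact change of the exponent when the relative degree passes from [U] to [U :\: Q]. *)
pose x vb := lam * (u * (ddeg vb Q)%:R - c * (ddeg vb U)%:R) / (u * (u - c)).
have wE vb : weight lam beta (U :\: Q) vb = w vb * expR (x vb).
  rewrite /w /weight -expRD u'E -/u; congr expR; rewrite /x dE natrD.
  by field; rewrite !gt_eqF.
have xb vb : `|x vb| <= L * c.
  have Lb : lam * c / (u - c) <= L * c.
    by rewrite mulrAC ler_wpM2r // ler_pdivrMr.
  have q1 : (ddeg vb Q)%:R <= c.
    by rewrite ler_nat; apply/subset_leq_card/subsetP => z; rewrite inE => /andP[].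
  have q2 : (ddeg vb U)%:R <= u.
    by rewrite ler_nat; apply/subset_leq_card/subsetP => z; rewrite inE => /andP[].
  apply: le_trans Lb; have -> : lam * c / (u - c) = lam * (u * c) / (u * (u - c)).
    by field; rewrite !gt_eqF.
  have inv0 : 0 <= (u * (u - c))^-1 by rewrite invr_ge0 mulr_ge0 // ltW.
  rewrite /x normrM (ger0_norm inv0) ler_wpM2r //.
  rewrite normrM (gtr0_norm lam0) ler_wpM2l ?(ltW lam0) // ler_norml.
  have h1 : 0 <= u * (ddeg vb Q)%:R <= u * c.
    by rewrite mulr_ge0 ?ler0n ?(ltW u0) // ler_wpM2l // ltW.
  have h2 : 0 <= c * (ddeg vb U)%:R <= c * u.
    by rewrite mulr_ge0 ?ler0n // ler_wpM2l.
  by move: h1 h2 => /andP[? ?] /andP[? ?]; apply/andP; split; lra.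
have Phi0 : 0 <= Phi by apply: sumr_ge0 => vb _; apply: expR_ge0.
have sumx : \sum_vb w vb * x vb <= L * c * delta * Phi.
  have -> : \sum_vb w vb * x vb = lam / (u - c) *
    (\sum_vb w vb * (ddeg vb Q)%:R - c * ((\sum_vb w vb * (ddeg vb U)%:R) / u)).
    rewrite mulr_suml mulr_sumr -sumrB mulr_sumr; apply: eq_bigr => vb _.
    by rewrite /x; field; rewrite !gt_eqF.
  have LL : lam / (u - c) <= L by rewrite ler_pdivrMr.
  have d0 : 0 <= delta by lra.
  apply: le_trans (_ : lam / (u - c) * (c * delta * Phi) <= _).
    rewrite ler_wpM2l ?divr_ge0 ?(ltW lam0) ?(ltW uc) //.
    by move: HQ; lra.
  have -> : L * c * delta * Phi = L * (c * delta * Phi) by ring.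
  by rewrite ler_wpM2r ?mulr_ge0.
apply: le_trans (_ : Phi * (1 + 2 * L * delta * c) <= _); last first.
  by rewrite ler_wpM2l // expR_ge1Dx.
apply: le_trans (_ : \sum_vb (w vb * (1 + 2 * (L * c) ^+ 2) + w vb * x vb) <= _).
  apply: ler_sum => vb _; rewrite wE -mulrDr ler_wpM2l ?expR_ge0 //.
  have xs : `|x vb| <= 2^-1 by apply: le_trans (xb vb) _; lra.
  apply: le_trans (expR_quadratic xs) _.
  have : x vb ^+ 2 <= (L * c) ^+ 2 by rewrite -(real_normK (num_real _)) lerXn2r ?nnegrE.
  by lra.
rewrite big_split /= -mulr_suml -/Phi.
(* Since [2 * (L * c) <= delta], the quadratic terms are at most the bound on the linear ones,
   whence the factor 2 in the exponent. *)
have : (L * c) ^+ 2 * Phi <= L * c * (delta / 2) * Phi.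
  by rewrite ler_wpM2r // expr2 ler_wpM2l //; lra.
have -> : \sum_vb w vb = Phi by [].
by move: sumx; lra.
Qed.
End Potential.

(** * Embedding the whole tree piece by piece *)

Section Core.
Variables (R : realType) (G T : digraph) (p : T -> option T) (k : T -> nat) (Delta : nat).
Hypothesis p_edge : forall a b, p a = Some b -> uadj a b /\ k a = (k b).+1.
Hypothesis edge_p : forall a b, uadj a b -> p a = Some b \/ p b = Some a.
Hypothesis orT : oriented T.
Hypothesis children : forall q, (#|[set t | p t == Some q]| <= Delta)%N.
Hypothesis Delta_gt0 : (0 < Delta)%N.

(** [e] is the degree surplus to be kept, [mu] the proportion of vertices of [G] left over, [delta]
    the relative error allowed per vertex, [lam] the sharpness of the potential, [m] the least size
    of a piece whose root has a parent, [r] the number of generations until the walk is mixed. *)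
Variables (e mu delta lam : R) (m r : nat).
Let N : R := #|G|%:R.
Let M : nat := (1 + Delta * m)%N.
Hypotheses (e_gt0 : 0 < e) (mu_gt0 : 0 < mu) (lam_gt0 : 0 < lam).
Hypotheses (delta_gt0 : 0 < delta) (delta_le1 : delta <= 1).
Hypothesis deg : forall (v : G) b, (2^-1 + 2 * e) * N <= #|[set y | dir_edge b v y]|%:R.
Hypothesis room : mu * N <= N - #|T|%:R.
Hypothesis N_large : 2 <= e * (mu * N).
Hypothesis M_small : 4 * M%:R <= e * (mu * N).
Hypothesis M_small' : 4 * M%:R / (e * (mu * N)) / e ^+ 2 <= delta / 2.
Hypothesis m_large : (r * Delta ^ r)%:R <= delta / 4 * m%:R.
Hypothesis r_large : (1 - e ^+ 2) ^+ r <= delta / 4.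
Hypothesis lam_small : 2 * (lam / (mu * N) * M%:R) <= delta.
Hypothesis lam_large :
  2 * N * expR (- (lam * e)) * expR (2 * (lam / (mu * N)) * delta * #|T|%:R) < 1.

Let L := lam / (mu * N).
Let Phi0 := 2 * N * expR (- (lam * e)).

Let muN_gt0 : 0 < mu * N.
Proof. by rewrite -(pmulr_rgt0 _ e_gt0) (lt_le_trans _ N_large). Qed.

Let N_gt0 : 0 < N.
Proof. by have := muN_gt0; rewrite pmulr_rgt0. Qed.

Let L_gt0 : 0 < L.
Proof. by rewrite divr_gt0. Qed.

Let extend (S D : {set T}) x (f0 : T -> G) :
  piece p S D x -> (#|D| <= M)%N -> p x = None \/ (m <= #|D|)%N ->
  parent_closed p S -> embeds (S :\: D) f0 ->
  @potential R G lam (2^-1 + e) (~: (f0 @: (S :\: D))) <=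
    Phi0 * expR (2 * L * delta * #|S :\: D|%:R) ->
  exists f, embeds S f /\
    @potential R G lam (2^-1 + e) (~: (f @: S)) <= Phi0 * expR (2 * L * delta * #|S|%:R).
Proof.
move=> pD DM xm cS emb0; set A := S :\: D in emb0 *; set U := ~: (f0 @: A).
set Phi := @potential R G lam (2^-1 + e) U => PhiU.
have SE : A :|: D = S.
  apply/setP => t; rewrite !inE; case tD: (t \in D); rewrite ?orbT ?orbF //=.
  by rewrite (subsetP (piece_sub pD) _ tD).
have cardAD : (#|S| = #|A| + #|D|)%N.
  by rewrite cardsD (setIidPr (piece_sub pD)) subnK // subset_leq_card // (piece_sub pD).
have fA : #|f0 @: A| = #|A| by rewrite card_in_imset //; case: emb0.
have UE : #|U|%:R = N - #|A|%:R :> R.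
  by rewrite -fA /N -(cardsC (f0 @: A)) natrD addrAC subrr add0r.
have ST : #|S|%:R <= #|T|%:R :> R by rewrite ler_nat max_card.
have AS : #|A|%:R + #|D|%:R = #|S|%:R :> R by rewrite cardAD natrD.
have D0 : 0 <= #|D|%:R :> R by [].
have Umu : mu * N <= #|U|%:R - #|D|%:R by rewrite UE; have := room; lra.
have Umu' : mu * N <= #|U|%:R by lra.
have U0 : 0 < #|U|%:R :> R by rewrite (lt_le_trans muN_gt0).
have eU : e * (mu * N) <= e * #|U|%:R by rewrite ler_wpM2l // ltW.
have eu : 2 <= e * #|U|%:R by apply: le_trans eU.
have MU : 4 * M%:R <= e * #|U|%:R by apply: le_trans eU.
(* The bound on the potential increases with the number of embedded vertices, so its value for all
   of [T], in [lam_large], suffices. *)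
have Phi1 : Phi < 1.
  apply: le_lt_trans PhiU _; apply: le_lt_trans lam_large.
  have c0 : 0 <= 2 * L * delta.
    by apply: mulr_ge0; [apply: mulr_ge0 => //; exact: ltW | exact: ltW].
  rewrite ler_wpM2l ?mulr_ge0 ?expR_ge0 // ler_expR ler_wpM2l //.
  by lra.
have degU (v : G) b : (2^-1 + e) * #|U|%:R <= #|[set y in U | dir_edge b v y]|%:R :> R.
  have : weight lam (2^-1 + e) U (v, b) < 1.
    apply: le_lt_trans Phi1; rewrite /Phi /potential (bigD1 (v, b)) //= lerDl.
    by apply: sumr_ge0 => vb _; apply: expR_ge0.
  rewrite /weight /ddeg /= -[ltRHS]expR0 ltr_expR pmulr_rlt0 // subr_lt0.
  by rewrite ltr_pdivlMr // => /ltW.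
have degE : semideg_ge (@edge G) U ((2^-1 + e) * #|U|%:R).
  by move=> v _; split; [exact: (degU v true) | exact: (degU v false)].
have [P [K K']] := kernel_exists e_gt0 eu degE.
have cA : parent_closed p A by exact: (piece_compl pD).
have f0U t : t \in A -> f0 t \notin U by move=> tA; rewrite inE negbK imset_f.
have dDA : [disjoint D & A].
  by rewrite disjoint_sym disjoints_subset; apply/subsetP => t; rewrite !inE => /andP[].
have cAD : parent_closed p (A :|: D) by rewrite SE.
have e1 : e ^+ 2 <= 1.
  have e_le1 : e <= 1.
    have /card_gt0P[v _] : (0 < #|U|)%N by rewrite -(ltr0n R).
    have : (#|[set y in U | dir_edge true v y]| <= #|U|)%N.
      by apply/subset_leq_card/subsetP => z; rewrite in_set => /andP[].
    rewrite -(ler_nat R) => h; have := le_trans (degU v true) h.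
    by rewrite -[leRHS]mul1r ler_pM2r //; lra.
  by rewrite exprn_ile1 // ltW.
have e2 : 0 <= e ^+ 2 by rewrite exprn_ge0 // ltW.
pose W (t : T) := cost lam (2^-1 + e) U.
(* Influence of the already embedded parent of [x]: none if [x] is a root, otherwise damped by
   [1 - e ^+ 2] per generation. *)
pose a t : R := if p x is None then 0 else (1 - e ^+ 2) ^+ (k t - k x).
have osc t y z : t \in D -> y \in U -> z \in U -> W t y - W t z <= Phi.
  by move=> _ _ _; have := cost_ge0 lam (2^-1 + e) U z; have := cost_le lam (2^-1 + e) U y; rewrite /W -/Phi; lra.
have p_depth b c : p b = Some c -> k b = (k c).+1 by case/p_edge.
have a0 t : t \in D -> 0 <= a t.
  by move=> _; rewrite /a; case: (p x) => // q; rewrite exprn_ge0 // subr_ge0.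
have ap t q : t \in D -> p t = Some q -> if q \in D then (1 - e ^+ 2) * a q <= a t else 1 <= a t.
  move=> tD ptq; case: ifP => qD; rewrite /a.
    case: (p x) => [_|]; last by rewrite mulr0.
    rewrite -exprS (p_depth _ _ ptq) subSn //; exact: (piece_depth p_depth pD qD).
  have tx : t = x.
    apply/eqP; apply: contraFT qD => tx.
    by have [q' + q'D] := piece_parent pD tD tx; rewrite ptq => -[->].
  by rewrite -tx ptq subnn expr0.
have [f [fA0 fD fe fW]] :=
  extend_piece p_edge edge_p orT e_gt0 eu degU K K' cA emb0 f0U MU dDA cAD DM osc a0 ap.
rewrite SE in fe; exists f; split=> //.
have fDU : f @: D \subset U by apply/subsetP => _ /imsetP[t tD ->]; apply: fD.
have finj : {in S &, injective f} by case: fe.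
have fcD : #|f @: D| = #|D|.
  by apply: card_in_imset => t t' /(subsetP (piece_sub pD)) tS /(subsetP (piece_sub pD)) tS'; apply: finj.
have fSE : ~: (f @: S) = U :\: f @: D.
  rewrite -SE imsetU setCU setDE; congr (~: _ :&: _); apply: eq_in_imset => t; exact: fA0.
(* For a non-root [x], the early generations give [delta / 4] by [m_large] and [m <= #|D|], the
   later ones [delta / 4] by [r_large]. The other [delta / 2] pays for avoiding used vertices. *)
have suma : \sum_(t in D) a t <= delta / 2 * #|D|%:R.
  rewrite /a; case: xm => [->|mD]; first by rewrite big1 // mulr_ge0 // divr_ge0 // ltW.
  case: (p x) => [_|]; last by rewrite big1 // mulr_ge0 // divr_ge0 // ltW.
  apply: le_trans (sum_piece_decay p_depth children Delta_gt0 pD r _ _) _; rewrite ?subr_ge0 ?gerBl //.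
  have h1 : delta / 4 * m%:R <= delta / 4 * #|D|%:R.
    by rewrite ler_wpM2l ?ler_nat // divr_ge0 // ltW.
  have h2 : (1 - e ^+ 2) ^+ r * #|D|%:R <= delta / 4 * #|D|%:R by rewrite ler_wpM2r.
  by have := m_large; lra.
have Phi_ge0 : 0 <= Phi by apply: sumr_ge0 => vb _; apply: expR_ge0.
have costD : \sum_(z in f @: D) cost lam (2^-1 + e) U z <=
    #|f @: D|%:R * (avg U (cost lam (2^-1 + e) U) + delta * Phi).
  rewrite big_imset /=; last first.
    by move=> t t' /(subsetP (piece_sub pD)) tS /(subsetP (piece_sub pD)) tS'; apply: finj.
  apply: le_trans fW _; rewrite fcD big_split /= -mulr_sumr big_split /= sumr_const.
  rewrite /W sumr_const -(mulr_natl (avg _ _)) [leRHS]mulrDr lerD2l.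
  have -> : #|D|%:R * (delta * Phi) = Phi * (delta * #|D|%:R) by ring.
  rewrite ler_wpM2l //.
  have h : 4 * M%:R / (e * #|U|%:R) / e ^+ 2 <= delta / 2.
    apply: le_trans M_small'; rewrite ler_wpM2r ?invr_ge0 // ler_wpM2l ?mulr_ge0 //.
    by rewrite lef_pV2 // posrE mulr_gt0.
  have : #|D|%:R * (4 * M%:R / (e * #|U|%:R) / e ^+ 2) <= #|D|%:R * (delta / 2).
    by rewrite ler_wpM2l.
  by rewrite -(mulr_natl (_ / _)); lra.
have LE : lam = L * (mu * N) by rewrite /L divfK // gt_eqF.
have LMD : L * #|D|%:R <= L * M%:R by rewrite ler_wpM2l ?(ltW L_gt0) // ler_nat.
have DU : (#|f @: D| < #|U|)%N.
  by rewrite fcD -(ltr_nat R); have := muN_gt0; lra.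
have := @potential_step R G lam (2^-1 + e) U (f @: D) L delta fDU lam_gt0 DU.
rewrite fcD -fSE => H; apply: le_trans (H _ delta_le1 _ _) _.
- by rewrite {1}LE ler_wpM2l // ltW.
- by have := lam_small; rewrite -/L; lra.
- by rewrite -fcD.
rewrite cardAD natrD mulrDr expRD mulrA ler_wpM2r ?expR_ge0 //.
Qed.

(** Induction on parent-closed sets: a piece is detached, the rest is embedded first, and the piece
    is added by [extend]. *)
Lemma core_embedding : exists f : T -> G, embeds [set: T] f.
Proof.
suff H (S : {set T}) : parent_closed p S -> exists f, embeds S f /\
    @potential R G lam (2^-1 + e) (~: (f @: S)) <= Phi0 * expR (2 * L * delta * #|S|%:R).
  by have [|f [fe _]] := H [set: T]; [move=> a b _ _; rewrite inE | exists f].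
have [j] := ubnP #|S|; elim: j S => // j IH S cS_lt cS.
have [S0|S0] := eqVneq S set0.
  have /card_gt0P[v _] : (0 < #|G|)%N by rewrite -(ltr0n R).
  exists (fun=> v); split; first by rewrite S0; split=> t t'; rewrite inE.
  rewrite S0 imset0 setC0 cards0 mulr0 expR0 mulr1 /potential /Phi0.
  apply: le_trans (_ : \sum_(vb : G * bool) expR (- (lam * e)) <= _).
    apply: ler_sum => -[v' b] _; rewrite /weight ler_expR -(mulrN lam e) ler_wpM2l ?(ltW lam_gt0) //.
    have -> : ddeg (v', b) [set: G] = #|[set y | dir_edge b v' y]|.
      by apply: eq_card => y; rewrite !inE.
    suff : 2^-1 + 2 * e <= #|[set y | dir_edge b v' y]|%:R / #|[set: G]|%:R by lra.
    by rewrite cardsT ler_pdivlMr.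
  by rewrite sumr_const card_prod card_bool -(mulr_natl (expR _)) natrM (mulrC #|G|%:R).
have p_depth b c : p b = Some c -> k b = (k c).+1 by case/p_edge.
have [D [x [pD DM xm]]] := piece_exists p_depth children Delta_gt0 m cS S0.
have ltS : (#|S :\: D| < #|S|)%N.
  rewrite cardsD (setIidPr (piece_sub pD)) ltn_subrL !card_gt0 S0 andbT.
  by apply/set0Pn; exists x; apply: (piece_root pD).
have [f0 [emb0 Phif0]] := IH (S :\: D) (leq_trans ltS cS_lt) (piece_compl pD).
exact: (extend pD DM xm cS emb0 Phif0).
Qed.

End Core.

(** * Elementary asymptotic estimates *)

Section Asymptotics.
Variable R : realType.

(** With [l = ln n] the power is [expR (r * l / sqrt (K * l))], at most [sqrt n] once
    [K * l >= 4 * r ^+ 2]; and [C <= sqrt n] once [n >= C ^+ 2]. *)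
Lemma powR_subpolynomial (K C : R) (r : nat) : 0 < K -> 0 < C -> (0 < r)%N ->
  exists n0 : nat, forall n : nat, (n0 <= n)%N ->
    C * (n%:R `^ ((K * ln n%:R) `^ (- 2^-1))) ^+ r <= n%:R.
Proof.
move=> K0 C0 r0; set rr := r%:R : R; have rr0 : 0 < rr by rewrite ltr0n.
have [n0 n0P] : exists n0 : nat, expR (4 * rr ^+ 2 / K) + C ^+ 2 <= n0%:R.
  exists (Num.bound (expR (4 * rr ^+ 2 / K) + C ^+ 2)).
  by apply/ltW/archi_boundP; rewrite addr_ge0 ?expR_ge0 ?sqr_ge0.
exists n0 => n nn0.
have nP : expR (4 * rr ^+ 2 / K) + C ^+ 2 <= n%:R by apply: le_trans n0P _; rewrite ler_nat.
have x0 := expR_gt0 (4 * rr ^+ 2 / K); have c0 := sqr_ge0 C.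
have n_gt0 : 0 < n%:R :> R by lra.
set l := ln n%:R.
have lE : expR l = n%:R by rewrite lnK.
have l_ge : 4 * rr ^+ 2 / K <= l by rewrite -ler_expR lE; lra.
have Kl : (2 * rr) ^+ 2 <= K * l.
  by move: l_ge; rewrite ler_pdivrMr // => h; rewrite exprMn -natrX mulrC [K * l]mulrC mulrC.
have Kl0 : 0 < K * l by rewrite (lt_le_trans _ Kl) // exprn_gt0 // mulr_gt0.
have l0 : 0 < l by move: Kl0; rewrite pmulr_rgt0.
have s_le : (K * l) `^ (- 2^-1) <= (2 * rr)^-1.
  rewrite powRN powR12_sqrt ?(ltW Kl0) // lef_pV2 ?posrE ?sqrtr_gt0 ?mulr_gt0 //.
  have -> : 2 * rr = Num.sqrt ((2 * rr) ^+ 2) by rewrite sqrtr_sqr gtr0_norm // mulr_gt0.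
  by rewrite ler_wsqrtr.
have -> : n%:R `^ ((K * l) `^ (- 2^-1)) = expR ((K * l) `^ (- 2^-1) * l).
  by rewrite {1}/powR gt_eqF.
rewrite -expRM_natl -/rr.
have h1 : expR (rr * ((K * l) `^ (- 2^-1) * l)) <= expR (l / 2).
  rewrite ler_expR mulrA mulrC ler_wpM2l ?(ltW l0) //.
  have := s_le; rewrite invfM => h; rewrite -(ler_pM2l (_ : 0 < rr^-1)) ?invr_gt0 //.
  by rewrite mulrA mulVf ?gt_eqF // mul1r [leRHS]mulrC.
have h2 : C <= expR (l / 2).
  have : C ^+ 2 <= expR (l / 2) ^+ 2.
    by rewrite -expRM_natl mulrCA divff ?mulr1 // lE; lra.
  by rewrite ler_pXn2r // nnegrE ?expR_ge0 // ltW.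
have -> : n%:R = expR (l / 2) * expR (l / 2) by rewrite -expRD -splitr.
by apply: ler_pM => //; exact: ltW.
Qed.

(** [(1 - rho) ^+ r <= expR (- (r * rho)) <= 1 / (1 + r * rho)], which is at most [eps] for
    [r > 1 / (rho * eps)]. *)
Lemma geometric_small (rho eps : R) : 0 < rho -> rho <= 1 -> 0 < eps ->
  exists2 r : nat, (0 < r)%N & (1 - rho) ^+ r <= eps.
Proof.
move=> rho0 rho1 eps0; have x0 : 0 < (rho * eps)^-1 by rewrite invr_gt0 mulr_gt0.
exists (Num.bound (rho * eps)^-1).
  by rewrite -(ltr_nat R) (lt_trans x0) // archi_boundP // ltW.
set r := Num.bound _; have rP : (rho * eps)^-1 < r%:R by rewrite archi_boundP // ltW.
apply: le_trans (_ : expR (- rho) ^+ r <= _).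
  by rewrite lerXn2r ?nnegrE ?expR_ge0 ?subr_ge0 // expR_ge1Dx.
rewrite -expRM_natl mulrN expRN -[leRHS]invrK lef_pV2 ?posrE ?expR_gt0 ?invr_gt0 //.
apply: le_trans (_ : 1 + r%:R * rho <= _); last exact: expR_ge1Dx.
have : (rho * eps)^-1 * rho <= r%:R * rho by rewrite ler_wpM2r // ltW.
by rewrite invfM mulrAC mulVf ?mul1r ?gt_eqF //; lra.
Qed.

(** The product is at most the square of the larger factor. *)
Lemma mul_le_of_pow4 (c M N : R) : 1 <= M -> 1 <= c -> M ^+ 4 <= N -> c ^+ 2 <= N -> c * M <= N.
Proof.
move=> M1 c1 MN cN; have [cM|Mc] := leP c M.
  apply: le_trans MN; apply: le_trans (_ : M ^+ 2 <= _); last exact: ler_weXn2l.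
  by rewrite expr2 ler_wpM2r //; lra.
by apply: le_trans cN; rewrite expr2 ler_wpM2l //; lra.
Qed.
End Asymptotics.

(** * Choice of the constants *)

Section Main.
Variables (R : realType) (G T : digraph).

Lemma min_semideg_le (v : G) (b : bool) :
  (min_semideg G <= #|[set y | dir_edge b v y]|)%N.
Proof.
have -> : #|[set y | dir_edge b v y]| = if b then outdeg v else indeg v.
  by case: b.
apply: (@leq_trans (minn (outdeg v) (indeg v))); last first.
  by case: b; [exact: geq_minl | exact: geq_minr].
rewrite /min_semideg; have := mem_index_enum v; elim: (index_enum _) => // w s IH.
rewrite inE big_cons => /orP[/eqP <-|/IH le]; first exact: geq_minl.
exact: leq_trans (geq_minr _ _) le.
Qed.

(* The constants of [core_embedding] are specialised to [mu = 2 e] and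
   [delta = e ^+ 2 / 2]; [lam] is then the largest value allowed by [lam_small]. *)
Lemma embedding_of_constants (e : R) (r q : nat) :
  oriented_tree T -> 0 < e -> e <= 2^-1 ->
  (forall (v : G) b, (2^-1 + 2 * e) * #|G|%:R <= #|[set y | dir_edge b v y]|%:R :> R) ->
  2 * e * #|G|%:R <= #|G|%:R - #|T|%:R :> R ->
  (1 - e ^+ 2) ^+ r <= e ^+ 2 / 8 -> r%:R <= e ^+ 2 / 8 * q%:R ->
  let M := (1 + (max_deg T).+1 * (q * (max_deg T).+1 ^ r))%N in
  M%:R ^+ 4 <= #|G|%:R :> R -> 512 * M%:R <= e ^+ 8 * #|G|%:R ->
  exists f : T -> G, embeds [set: T] f.
Proof.
move=> [orT _ acyc] e0 eh deg room rl ql M M4 ML.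
have [p [k [p_edge edge_p]]] := acyclic_parent acyc.
(* The successor keeps [Delta] positive even for a tree with a single vertex. *)
set N := #|G|%:R in deg room M4 ML *; set Delta := (max_deg T).+1 in M M4 ML.
have children q' : (#|[set t | p t == Some q']| <= Delta)%N.
  apply: leqW; apply: leq_trans (leq_bigmax q').
  apply/subset_leq_card/subsetP => t; rewrite !inE => /eqP /p_edge[+ _].
  by rewrite uadj_sym.
set M' : R := M%:R in M4 ML.
have M1 : 1 <= M' by rewrite /M' /M natrD lerDl.
have E0 : 0 < e ^+ 2 by rewrite exprn_gt0.
have E1 : e ^+ 2 <= 4^-1.
  have -> : 4^-1 = 2^-1 ^+ 2 :> R by rewrite exprVn -natrX.
  by rewrite lerXn2r ?nnegrE // ltW.
have N0 : 0 < N.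
  have e80 : 0 < e ^+ 8 by rewrite exprn_gt0.
  by rewrite -(pmulr_rgt0 _ e80); lra.
have e8 j : (j <= 8)%N -> e ^+ 8 * N <= e ^+ j * N.
  by move=> j8; rewrite ler_wpM2r ?(ltW N0) // ler_wiXn2l ?(ltW e0) //; lra.
have e2N := e8 2 isT; have e6N := e8 6 isT.
have eqN : e * (2 * e * N) = 2 * (e ^+ 2 * N) by rewrite expr2; ring.
have mu0 : 0 < 2 * e * N by rewrite !mulr_gt0.
pose lam : R := e ^+ 3 * N / (2 * M').
have lam0 : 0 < lam by rewrite divr_gt0 ?mulr_gt0 ?exprn_gt0 //; lra.
apply: (@core_embedding R G T p k Delta p_edge edge_p orT children isT
  e (2 * e) (e ^+ 2 / 2) lam (q * Delta ^ r) r) => //.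
- by rewrite mulr_gt0.
- by rewrite divr_gt0.
- by lra.
- by rewrite eqN; lra.
- by rewrite eqN -/M -/M'; lra.
- rewrite eqN -/M -/M' -/N ler_pdivrMr // ler_pdivrMr ?mulr_gt0 //.
  have -> : e ^+ 2 / 2 / 2 * e ^+ 2 * (2 * (e ^+ 2 * N)) = e ^+ 6 * N / 2 by field.
  by lra.
- rewrite !natrM; have -> : e ^+ 2 / 2 / 4 = e ^+ 2 / 8 by field.
  by rewrite mulrA ler_wpM2r.
- by have -> : e ^+ 2 / 2 / 4 = e ^+ 2 / 8 by field.
- rewrite -/M -/M' -/N /lam le_eqVlt; apply/orP; left; apply/eqP; field.
  by rewrite !gt_eqF //; lra.
rewrite -/N.
(* Half of [lam * e]. As [#|T| <= N], the growth of the potential uses up at most [expR y], and the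
   remaining [expR (- y)] has to beat [2 * N]. *)
set y := e ^+ 4 * N / (4 * M').
have y0 : 0 <= y by rewrite divr_ge0 ?mulr_ge0 ?exprn_ge0 ?ltW //; lra.
have yE : lam * e = 2 * y by rewrite /lam /y; field; rewrite gt_eqF //; lra.
have expy : 2 * N < expR y.
  have -> : expR y = expR (y / 4) ^+ 4 by rewrite -expRM_natl mulrCA divff ?mulr1.
  apply: lt_le_trans (_ : (y / 4) ^+ 4 <= _); last first.
    have y40 : 0 <= y / 4 by rewrite mulr_ge0 // invr_ge0.
    rewrite lerXn2r ?nnegrE ?expR_ge0 //.
    by apply: le_trans (expR_ge1Dx _); lra.
  (* Here [M' ^+ 4 <= N] leaves a factor [N], and [e ^+ 8 * N >= 512] makes the square exceed 2. *)
  have -> : (y / 4) ^+ 4 = (e ^+ 8 * N / 256) ^+ 2 * (N ^+ 2 / M' ^+ 4).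
    by rewrite /y; field; rewrite gt_eqF //; lra.
  have M40 : 0 < M' ^+ 4 by rewrite exprn_gt0 //; lra.
  have h1 : N <= N ^+ 2 / M' ^+ 4 by rewrite ler_pdivlMr // expr2 ler_wpM2l // ltW.
  have h2 : 2 < (e ^+ 8 * N / 256) ^+ 2.
    have h : 2 <= e ^+ 8 * N / 256 by lra.
    by rewrite expr2; nra.
  apply: lt_le_trans (_ : (e ^+ 8 * N / 256) ^+ 2 * N <= _).
    by rewrite ltr_pM2r.
  by rewrite ler_wpM2l // sqr_ge0.
rewrite yE -[X in X < _]mulrA -expRD.
have TN : #|T|%:R <= N by lra.
have -> : 2 * (lam / (2 * e * N)) * (e ^+ 2 / 2) * #|T|%:R = y * (#|T|%:R / N).
  by rewrite -[y](mulKf (_ : 2 != 0 :> R)) // -yE; field; rewrite !gt_eqF.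
have h : y * (#|T|%:R / N) <= y * 1 by rewrite ler_wpM2l // ler_pdivrMr // mul1r.
apply: le_lt_trans (_ : 2 * N * expR (- y) < _).
  by rewrite ler_wpM2l ?mulr_ge0 ?(ltW N0) // ler_expR; lra.
by rewrite expRN ltr_pdivrMr ?expR_gt0 // mul1r.
Qed.

End Main.

Theorem theorem1p8 (R : realType) (alpha : R) (alpha_gt0 : 0 < alpha) :
  exists2 lambda0 : R, 0 < lambda0 &
  forall lambda : R, 0 < lambda < lambda0 ->
  exists2 kappa0 : R, 0 < kappa0 &
  forall K : R, 0 < K^-1 < kappa0 ->
  exists n0 : nat, forall n : nat, (n0 <= n)%N ->
  forall G : digraph,
    rounding ((1 + alpha) * n%:R) (gorder G) ->
    (2^-1 + alpha) * n%:R <= (min_semideg G)%:R :> R ->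
  forall T : digraph,
    oriented_tree T ->
    gorder T = n ->
    (max_deg T)%:R <= n%:R `^ ((K * ln n%:R) `^ (- 2^-1)) :> R ->
  contains G T.
Proof.
exists 1 => // lambda _; exists 1 => // K /andP[K_gt0 _].
have K0 : 0 < K by rewrite -invr_gt0.
(* Relative to order [(1 + alpha) * n], both the degree surplus and the spare vertices must reach
   [2 * e]; the 8 leaves slack for the rounding error. *)
pose e : R := alpha / (8 * (1 + alpha)).
have a1 : 0 < 1 + alpha by lra.
have e0 : 0 < e by rewrite divr_gt0 // mulr_gt0.
have eE : e * (1 + alpha) = alpha / 8 by rewrite /e; field; rewrite gt_eqF.
have e8 : e <= 8^-1 by rewrite -(ler_pM2r a1) eE; lra.
have e2 : 0 < e ^+ 2 by rewrite exprn_gt0.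
have e2' : e ^+ 2 <= 1 by rewrite exprn_ile1 ?(ltW e0) //; lra.
have eps0 : 0 < e ^+ 2 / 8 by rewrite divr_gt0.
have [r r0 rl] := geometric_small e2 e2' eps0.
have [q ql] : exists q : nat, r%:R <= e ^+ 2 / 8 * q%:R.
  exists (Num.bound (r%:R / (e ^+ 2 / 8))).
  by rewrite mulrC -ler_pdivrMr // ltW // archi_boundP // divr_ge0 // ltW.
(* With [X] the degree bound, [Delta <= 2 * X] and so [M ^+ 4 <= C * X ^+ (4 * (r + 1))]. *)
pose C : R := ((1 + q%:R) * 2 ^+ r.+1) ^+ 4.
have C0 : 0 < C by rewrite exprn_gt0 // mulr_gt0 ?exprn_gt0 // ltr_pwDl.
have [n1 n1P] := powR_subpolynomial K0 C0 (isT : (0 < r.+1 * 4)%N).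
pose c : R := 512 / e ^+ 8.
have e80 : 0 < e ^+ 8 by rewrite exprn_gt0.
have c1 : 1 <= c.
  have : e ^+ 8 <= 1 by rewrite exprn_ile1 ?(ltW e0) //; lra.
  by rewrite /c ler_pdivlMr //; lra.
(* The first term gives [alpha * n >= 4], which absorbs the rounding; the second gives [c * M <= N]
   through [mul_le_of_pow4]. *)
have [n2 n2P] : exists n2 : nat, 4 / alpha + c ^+ 2 <= n2%:R.
  exists (Num.bound (4 / alpha + c ^+ 2)).
  by apply/ltW/archi_boundP; rewrite addr_ge0 ?sqr_ge0 // divr_ge0 // ltW.
exists (n1 + n2)%N => n n12 G NG degG T treeT orderT degT.
have {}n1P := n1P n (leq_trans (leq_addr _ _) n12).
have nP : 4 / alpha + c ^+ 2 <= n%:R.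
  by apply: le_trans n2P _; rewrite ler_nat (leq_trans (leq_addl _ _) n12).
have c2 : 1 <= c ^+ 2 by rewrite exprn_ege1.
have a4 : 0 < 4 / alpha by rewrite divr_gt0.
have an : 4 <= alpha * n%:R by rewrite mulrC -ler_pdivrMr //; lra.
move: NG; rewrite /rounding /gorder ltr_distl => /andP[N1 N2].
set N : R := #|G|%:R in N1 N2.
have nN : n%:R <= N by lra.
have N0 : 0 < N by lra.
suff [f [finj fedge]] : exists f : T -> G, embeds [set: T] f.
  apply/containsP; exists f => [x y|x y]; first by apply: finj; rewrite inE.
  by apply: fedge; rewrite inE.
set X := n%:R `^ _ in degT n1P.
have X1 : 1 <= X.
  rewrite -(powRr0 n%:R) /X; apply: ler_powR; last exact: powR_ge0.
  by lra.
have DX : (max_deg T).+1%:R <= 2 * X by rewrite -natr1; lra.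
have M4 : (1 + (max_deg T).+1 * (q * (max_deg T).+1 ^ r))%:R ^+ 4 <= n%:R :> R.
  apply: le_trans n1P; rewrite /C exprM -exprMn lerXn2r ?nnegrE //.
    by rewrite !mulr_ge0 ?exprn_ge0 ?addr_ge0 //; lra.
  rewrite -mulrA -exprMn mulnCA -expnS natrD natrM natrX.
  have h : (max_deg T).+1%:R ^+ r.+1 <= (2 * X) ^+ r.+1.
    by rewrite lerXn2r ?nnegrE //; lra.
  have h1 : 1 <= (2 * X) ^+ r.+1 by rewrite exprn_ege1 //; lra.
  have : q%:R * (max_deg T).+1%:R ^+ r.+1 <= q%:R * (2 * X) ^+ r.+1 by rewrite ler_wpM2l.
  by lra.
apply: (@embedding_of_constants R G T e r q) => //.
- by lra.
- move=> v b; apply: le_trans (_ : (2^-1 + alpha) * n%:R <= _); last first.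
    by apply: le_trans degG _; rewrite ler_nat min_semideg_le.
  rewrite -/N; have h : (2^-1 + 2 * e) * N <= (2^-1 + 2 * e) * ((1 + alpha) * n%:R + 1).
    by rewrite ler_wpM2l //; lra.
  have eEn : e * (1 + alpha) * n%:R = alpha / 8 * n%:R by rewrite eE.
  by lra.
- rewrite -/N; move: orderT; rewrite /gorder => ->.
  have h : (1 - 2 * e) * ((1 + alpha) * n%:R - 1) <= (1 - 2 * e) * N.
    by rewrite ler_wpM2l //; lra.
  have eEn : e * (1 + alpha) * n%:R = alpha / 8 * n%:R by rewrite eE.
  by lra.
- exact: le_trans M4 nN.
rewrite -/N.
have M1 : 1 <= (1 + (max_deg T).+1 * (q * (max_deg T).+1 ^ r))%:R :> R by rewrite ler1n.
have cN : c ^+ 2 <= N by lra.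
have := mul_le_of_pow4 M1 c1 (le_trans M4 nN) cN.
by rewrite /c mulrAC ler_pdivrMr // [N * _]mulrC.
Qed.
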